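(* Let $k$ be a field, let $\mathcal{S}$ be a finite $k$-species, and $\rho$ a set of relations on $\mathcal{S}$. Then the category $\operatorname{Rep}(\mathcal{S},\rho)$ and the category $\operatorname{Mod}(T(\mathcal{S})/\langle\rho\rangle)$ of left $T(\mathcal{S})/\langle\rho\rangle$-modules are equivalent.
   Context: Species. A $k$-species $\mathcal{S} = (D_i, {}_jM_i)_{i,j\in I}$ consists of division rings $D_i$, finite dimensional over a common central subfield $k$, and $D_j$-$D_i$-bimodules ${}_jM_i$, finite dimensional over $k$ with $\lambda m = m\lambda$ for $\lambda \in k$, $m\in {}_jM_i$. (Then automatically $\operatorname{Hom}_{D_i}({}_jM_i,D_i)\simeq \operatorname{Hom}_{D_j}({}_jM_i,D_j)$ as $D_i$-$D_j$-bimodules.) Its underlying quiver $Q_\mathcal{S}$ has vertex set $I$ and one arrow $i\to j$ for each ${}_jM_i\neq (0)$; $\mathcal{S}$ is finite if $Q_\mathcal{S}$ is finite. Put $D = \bigoplus_i D_i$, $M = \bigoplus_{i,j} {}_jM_i$ (a $D$-$D$-bimodule), $M^{(0)} = D$, and $M^{(n)}$ the $n$-fold tensor product of $M$ over $D$. The tensor algebra is $T(\mathcal{S}) = \bigoplus_{n\ge 0} M^{(n)}$ with multiplication given by the tensor product. Relations. A relation on $\mathcal{S}$ starting in $a\in I$ and ending in $b\in I$ is a finite sum $\sigma = g_1+\cdots+g_n$ where each $g_l = g_{l,n_l}\otimes\cdots\otimes g_{l,1}$, $n_l\ge 1$, is an elementary tensor in ${}_{i_{n_l}}M_{i_{n_l-1}}\otimes_{D_{i_{n_l-1}}}\cdots\otimes_{D_{i_1}}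 {}_{i_1}M_{i_0}$ for some path $a=i_0\to i_1\to\cdots\to i_{n_l}=b$ (depending on $l$) in $Q_\mathcal{S}$. A set of relations is a set $\rho$ of relations (possibly with different start and end vertices); $\langle\rho\rangle$ is the two-sided ideal of $T(\mathcal{S})$ it generates. Representations. A representation $V=(V_i,{}_j\phi_i)$ of $\mathcal{S}$ consists of left $D_i$-modules $V_i$ and left $D_j$-linear maps ${}_j\phi_i\colon {}_jM_i\otimes_{D_i}V_i\to V_j$; a morphism $V\to V'$ is a family of $D_i$-linear maps $\alpha_i\colon V_i\to V_i'$ with ${}_j\phi'_i\circ(1\otimes\alpha_i)=\alpha_j\circ{}_j\phi_i$ for all $i,j$. For $i,j\in I$ let ${}_j\mathcal{M}_i$ be the direct sum, over all paths $i=p(0)\to p(1)\to\cdots\to p(n_p)=j$ in $Q_\mathcal{S}$, of the $D_j$-$D_i$-bimodules ${}_jM_{p(n_p-1)}\otimes_{D_{p(n_p-1)}}\cdots\otimes_{D_{p(1)}}{}_{p(1)}M_i$; composing the ${}_j\phi_i$ along paths gives ${}_jf_i\colon{}_j\mathcal{M}_i\otimes_{D_i}V_i\to V_j$. $\operatorname{Rep}(\mathcal{S},\rho)$ is the full subcategory of the category of representations consisting of those $V$ such that, for every $\sigma\in\rho$ starting in $i$ and ending in $j$, ${}_jf_i$ vanishes on $N\otimes_{D_i}V_i$, where $N$ is the $D_j$-$D_i$-sub-bimodule of ${}_j\mathcal{M}_i$ generated by $\sigma$. *)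

(* Defs.v *)
From HB Require Import structures.
From mathcomp Require Import all_boot all_order all_algebra.
From mathcomp Require Import falgebra.
From mathcomp Require Import finmap all_classical.

Set Implicit Arguments.
Unset Strict Implicit.
Unset Printing Implicit Defensive.

Import GRing.Theory.
Local Open Scope classical_set_scope.
Local Open Scope ring_scope.
Local Open Scope quotient_scope.

(* S-R-bimodules: the left S-action is the lmodType structure, the right
   R-action is [ract]. *)
Record bimod (S R : pzRingType) := Bimod {
  bcar :> lmodType S;
  ract : bcar -> R -> bcar;
  ractDl : forall m m' r, ract (m + m') r = ract m r + ract m' r;
  ractDr : forall m r r', ract m (r + r') = ract m r + ract m r';
  ractA : forall m r r', ract (ract m r) r' = ract m (r * r');
  ract1 : forall m, ract m 1 = m;
  ractZ : forall s m r, ract (s *: m) r = s *: ract m r }.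

Section Regular.
Variable R : pzRingType.
Fact regular_ractZ (s m r : R^o) : (s *: m) * r = s *: (m * r).
Proof. by rewrite /GRing.scale /= mulrA. Qed.
Definition regular_bimod : bimod R R :=
  @Bimod R R R^o (fun m r => m * r) (fun m m' r => mulrDl m m' r)
    (fun m r r' => mulrDr m r r') (fun m r r' => esym (mulrA m r r'))
    (fun m => mulr1 m) regular_ractZ.
End Regular.

Definition additive_fun (U Z : zmodType) (g : U -> Z) :=
  forall x y, g (x + y) = g x + g y.

Lemma additive_fun0 (U Z : zmodType) (g : U -> Z) : additive_fun g -> g 0 = 0.
Proof. by move=> gD; apply: (addrI (g 0)); rewrite -gD !addr0. Qed.

Lemma additive_fun_sum (U Z : zmodType) (g : U -> Z) (J : Type) (s : seq J)
    (P : pred J) (F : J -> U) : additive_fun g ->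
  g (\sum_(j <- s | P j) F j) = \sum_(j <- s | P j) g (F j).
Proof. by move=> gD; apply: (big_morph g gD (additive_fun0 gD)). Qed.

(* Tensor product over R of an S-R-bimodule A and a left R-module B: formal
   finite sums of pairs, up to the congruence generated by biadditivity and
   R-balancedness. *)
Section Tensor.
Variables (S R : pzRingType) (A : bimod S R) (B : lmodType R).

Inductive tens_eqv : seq (A * B) -> seq (A * B) -> Prop :=
| tens_refl s : tens_eqv s s
| tens_sym s t : tens_eqv s t -> tens_eqv t s
| tens_trans s t u : tens_eqv s t -> tens_eqv t u -> tens_eqv s u
| tens_cat s s' t t' :
    tens_eqv s s' -> tens_eqv t t' -> tens_eqv (s ++ t) (s' ++ t')
| tens_comm s t : tens_eqv (s ++ t) (t ++ s)
| tens_zero b : tens_eqv [:: (0, b)] [::]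
| tens_addl a a' b : tens_eqv [:: (a + a', b)] [:: (a, b); (a', b)]
| tens_addr a b b' : tens_eqv [:: (a, b + b')] [:: (a, b); (a, b')]
| tens_bal a r b : tens_eqv [:: (ract a r, b)] [:: (a, r *: b)].

Definition tens_rel (s t : seq (A * B)) : bool := `[< tens_eqv s t >].

Fact tens_rel_equiv : equiv_class_of tens_rel.
Proof.
split=> [s|s t|t s u].
- by apply/asboolP; exact: tens_refl.
- by apply/asboolP/asboolP => /tens_sym.
- by move=> /asboolP st /asboolP tu; apply/asboolP; exact: tens_trans st tu.
Qed.

Canonical tens_rel_equivRel := EquivRelPack tens_rel_equiv.
Canonical tens_rel_encModRel := defaultEncModRel tens_rel.

Definition tens := {eq_quot tens_rel}.
HB.instance Definition _ : EqQuotient _ tens_rel tens := EqQuotient.on tens.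
HB.instance Definition _ := Choice.on tens.

Definition tsum (s : seq (A * B)) : tens := \pi_tens s.
Definition tensor (a : A) (b : B) : tens := tsum [:: (a, b)].

Lemma tsumP s t : tsum s = tsum t <-> tens_eqv s t.
Proof.
split=> [/eqmodP|st]; first by move/asboolP.
by apply/eqmodP/asboolP.
Qed.

Lemma tsum_repr (x : tens) : tsum (repr x) = x.
Proof. exact: reprK. Qed.

Lemma repr_tsum s : tens_eqv (repr (tsum s)) s.
Proof. by apply/tsumP; rewrite tsum_repr. Qed.

Definition tens_add (x y : tens) : tens := tsum (repr x ++ repr y).
Definition tens_scale (c : S) (x : tens) : tens :=
  tsum [seq (c *: p.1, p.2) | p <- repr x].
Definition tens_opp (x : tens) : tens :=
  tsum [seq (- p.1, p.2) | p <- repr x].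

Lemma tens_addE s t : tens_add (tsum s) (tsum t) = tsum (s ++ t).
Proof. by apply/tsumP; apply: tens_cat; apply: repr_tsum. Qed.

Lemma tens_map_eqv (g : A -> A) : additive_fun g ->
  (forall a r, g (ract a r) = ract (g a) r) ->
  forall s t, tens_eqv s t ->
  tens_eqv [seq (g p.1, p.2) | p <- s] [seq (g p.1, p.2) | p <- t].
Proof.
move=> gD gr s t; elim=> {s t} /=.
- by move=> s; exact: tens_refl.
- by move=> s t _; exact: tens_sym.
- by move=> s t u _ st _; exact: tens_trans st.
- by move=> s s' t t' _ h _ h'; rewrite !map_cat; exact: tens_cat.
- by move=> s t; rewrite !map_cat; exact: tens_comm.
- by move=> b; rewrite (additive_fun0 gD); exact: tens_zero.
- by move=> a a' b; rewrite gD; exact: tens_addl.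
- by move=> a b b'; exact: tens_addr.
- by move=> a r b; rewrite gr; exact: tens_bal.
Qed.

Fact ractN (a : A) r : ract (- a) r = - ract a r.
Proof.
apply: (addrI (ract a r)); rewrite -ractDl !subrr.
by apply: (addrI (ract 0 r)); rewrite -ractDl !addr0.
Qed.

Lemma tens_oppE s : tens_opp (tsum s) = tsum [seq (- p.1, p.2) | p <- s].
Proof.
apply/tsumP; apply: tens_map_eqv (repr_tsum s) => [x y|a r].
  by rewrite opprD.
by rewrite ractN.
Qed.

Lemma tens_scaleE c s :
  tens_scale c (tsum s) = tsum [seq (c *: p.1, p.2) | p <- s].
Proof.
apply/tsumP; apply: tens_map_eqv (repr_tsum s) => [x y|a r].
  by rewrite scalerDr.
by rewrite ractZ.
Qed.

Fact tens_addA : associative tens_add.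
Proof.
move=> x y z; rewrite -[x]tsum_repr -[y]tsum_repr -[z]tsum_repr.
by rewrite !tens_addE catA.
Qed.

Fact tens_addC : commutative tens_add.
Proof.
move=> x y; rewrite -[x]tsum_repr -[y]tsum_repr !tens_addE.
by apply/tsumP; exact: tens_comm.
Qed.

Fact tens_add0 : left_id (tsum [::]) tens_add.
Proof. by move=> x; rewrite -[x]tsum_repr tens_addE. Qed.

Fact tens_addN : left_inverse (tsum [::]) tens_opp tens_add.
Proof.
move=> x; rewrite -[x]tsum_repr tens_oppE tens_addE; apply/tsumP.
elim: (repr x) => [|[a b] s IHs] /=; first exact: tens_refl.
rewrite -cat1s -(cat1s (a, b)).
apply: (@tens_trans _ (([:: (- a, b)] ++ [:: (a, b)]) ++
    ([seq (- p.1, p.2) | p <- s] ++ s))).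
  rewrite -!catA; apply: tens_cat; first exact: tens_refl.
  by rewrite !catA; apply: tens_cat; [exact: tens_comm|exact: tens_refl].
rewrite -[X in tens_eqv _ X]cats0; apply: tens_cat => //.
apply: tens_trans (tens_zero b); apply: tens_sym.
by rewrite -(addNr a); exact: tens_addl.
Qed.

HB.instance Definition _ :=
  GRing.isZmodule.Build tens tens_addA tens_addC tens_add0 tens_addN.

Lemma tsumD s t : tsum (s ++ t) = tsum s + tsum t.
Proof. by rewrite -tens_addE. Qed.

Lemma tsum_sum s : tsum s = \sum_(p <- s) tensor p.1 p.2.
Proof.
elim: s => [|[a b] s IHs]; first by rewrite big_nil.
by rewrite big_cons -IHs -tsumD.
Qed.

Lemma tens_sum (x : tens) : x = \sum_(p <- repr x) tensor p.1 p.2.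
Proof. by rewrite -tsum_sum tsum_repr. Qed.

Lemma tens_ind (P : tens -> Prop) :
  P 0 -> (forall x y, P x -> P y -> P (x + y)) ->
  (forall a b, P (tensor a b)) -> forall x, P x.
Proof.
move=> P0 PD Pt x; rewrite (tens_sum x).
by elim/big_rec: _ => // p y _; apply: PD.
Qed.

Lemma tensorDl a a' b : tensor (a + a') b = tensor a b + tensor a' b.
Proof. by rewrite -tsumD; apply/tsumP; exact: tens_addl. Qed.

Lemma tensorDr a b b' : tensor a (b + b') = tensor a b + tensor a b'.
Proof. by rewrite -tsumD; apply/tsumP; exact: tens_addr. Qed.

Lemma tensor_bal a r b : tensor (ract a r) b = tensor a (r *: b).
Proof. by apply/tsumP; exact: tens_bal. Qed.

Fact tens_scaleA c d x : tens_scale c (tens_scale d x) = tens_scale (c * d) x.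
Proof.
rewrite -[x]tsum_repr !tens_scaleE -map_comp; congr tsum.
by apply: eq_map => p /=; rewrite scalerA.
Qed.

Fact tens_scale1 : left_id 1 tens_scale.
Proof.
move=> x; rewrite -[x]tsum_repr !tens_scaleE; congr tsum.
by rewrite -[RHS]map_id; apply: eq_map => -[a b] /=; rewrite scale1r.
Qed.

Fact tens_scaleDr : right_distributive tens_scale +%R.
Proof.
move=> c x y; rewrite -[x]tsum_repr -[y]tsum_repr -tsumD !tens_scaleE.
by rewrite map_cat tsumD.
Qed.

Fact tens_scale_tensor c a b : tens_scale c (tensor a b) = tensor (c *: a) b.
Proof. by rewrite tens_scaleE. Qed.

Fact tens_scale0 c : tens_scale c 0 = 0.
Proof. exact: (tens_scaleE c [::]). Qed.

Fact tens_scaleDl x : {morph tens_scale^~ x : c d / c + d}.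
Proof.
move=> c d; elim/tens_ind: x => [|x y IHx IHy|a b].
- by rewrite !tens_scale0 addr0.
- by rewrite !tens_scaleDr IHx IHy addrACA.
- by rewrite !tens_scale_tensor scalerDl tensorDl.
Qed.

HB.instance Definition _ := GRing.Zmodule_isLmodule.Build S tens
  tens_scaleA tens_scale1 tens_scaleDr tens_scaleDl.

Lemma tensorZ c a b : c *: tensor a b = tensor (c *: a) b.
Proof. exact: tens_scale_tensor. Qed.

(* The additive map A (x) B -> Z induced by beta; meaningful when beta is
   biadditive and balanced, see [tliftE]. *)
Definition tlift (Z : zmodType) (beta : A -> B -> Z) (x : tens) : Z :=
  \sum_(p <- repr x) beta p.1 p.2.

Definition balanced (Z : zmodType) (beta : A -> B -> Z) :=
  [/\ forall b, additive_fun (beta^~ b), forall a, additive_fun (beta a)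
    & forall a r b, beta (ract a r) b = beta a (r *: b)].

Lemma tlift_tsum (Z : zmodType) (beta : A -> B -> Z) s : balanced beta ->
  tlift beta (tsum s) = \sum_(p <- s) beta p.1 p.2.
Proof.
move=> [bDl bDr bB]; rewrite /tlift.
move: (repr (tsum s)) (repr_tsum s) => t st; elim: st => {s t} //.
- by move=> s t u _ -> _ ->.
- by move=> s s' t t' _ h _ h'; rewrite !big_cat /= h h'.
- by move=> s t; rewrite !big_cat /= addrC.
- by move=> b; rewrite big_seq1 big_nil; exact: (additive_fun0 (bDl b)).
- by move=> a a' b; rewrite !big_cons !big_nil !addr0 /= bDl.
- by move=> a b b'; rewrite !big_cons !big_nil !addr0 /= bDr.
- by move=> a r b; rewrite !big_seq1 /= bB.
Qed.

Lemma tliftE (Z : zmodType) (beta : A -> B -> Z) a b : balanced beta ->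
  tlift beta (tensor a b) = beta a b.
Proof. by move=> bal; rewrite tlift_tsum // big_seq1. Qed.

Lemma tliftD (Z : zmodType) (beta : A -> B -> Z) : balanced beta ->
  additive_fun (tlift beta).
Proof.
move=> bal x y; rewrite -[x]tsum_repr -[y]tsum_repr -tsumD.
by rewrite !tlift_tsum // big_cat.
Qed.

End Tensor.

(* A (x)_R B as an S-T-bimodule, when B is an R-T-bimodule *)
Section TensorBimod.
Variables (S R T : pzRingType) (A : bimod S R) (B : bimod R T).

Definition tens_ract (x : tens A B) (t : T) : tens A B :=
  tlift (fun a b => tensor a (ract b t)) x.

Fact tens_ract_bal t :
  balanced (fun (a : A) (b : B) => tensor a (ract b t) : tens A B).
Proof.
split=> [b a a'|a b b'|a r b].
- by rewrite tensorDl.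
- by rewrite ractDl tensorDr.
- by rewrite ractZ tensor_bal.
Qed.

Lemma tens_ract_tensor a b t :
  tens_ract (tensor a b) t = tensor a (ract b t).
Proof. by rewrite /tens_ract tliftE //; exact: tens_ract_bal. Qed.

Fact tens_ractDl x y t : tens_ract (x + y) t = tens_ract x t + tens_ract y t.
Proof. exact: (tliftD (tens_ract_bal t)). Qed.

Fact tens_ract0 t : tens_ract 0 t = 0.
Proof. exact: (additive_fun0 (tliftD (tens_ract_bal t))). Qed.

Fact tens_ractDr x t t' : tens_ract x (t + t') = tens_ract x t + tens_ract x t'.
Proof.
elim/tens_ind: x => [|x y IHx IHy|a b].
- by rewrite !tens_ract0 addr0.
- by rewrite !tens_ractDl IHx IHy addrACA.
- by rewrite !tens_ract_tensor ractDr tensorDr.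
Qed.

Fact tens_ractA x t t' : tens_ract (tens_ract x t) t' = tens_ract x (t * t').
Proof.
elim/tens_ind: x => [|x y IHx IHy|a b].
- by rewrite !tens_ract0.
- by rewrite !tens_ractDl IHx IHy.
- by rewrite !tens_ract_tensor ractA.
Qed.

Fact tens_ract1 x : tens_ract x 1 = x.
Proof.
elim/tens_ind: x => [|x y IHx IHy|a b].
- by rewrite !tens_ract0.
- by rewrite !tens_ractDl IHx IHy.
- by rewrite !tens_ract_tensor ract1.
Qed.

Fact tens_ractZ s x t : tens_ract (s *: x) t = s *: tens_ract x t.
Proof.
elim/tens_ind: x => [|x y IHx IHy|a b].
- by rewrite !(scaler0, tens_ract0).
- by rewrite scalerDr !tens_ractDl IHx IHy scalerDr.
- by rewrite !(tens_ract_tensor, tensorZ).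
Qed.

Definition tens_bimod : bimod S T :=
  Bimod tens_ractDl tens_ractDr tens_ractA tens_ract1 tens_ractZ.
End TensorBimod.

(* 1 (x) g *)
Definition tens_map (S R : pzRingType) (A : bimod S R) (B B' : lmodType R)
    (g : {linear B -> B'}) : tens A B -> tens A B' :=
  tlift (fun a b => tensor a (g b)).

Lemma tens_map_bal (S R : pzRingType) (A : bimod S R) (B B' : lmodType R)
    (g : {linear B -> B'}) :
  balanced (fun (a : A) (b : B) => tensor a (g b) : tens A B').
Proof.
split=> [b a a'|a b b'|a r b].
- by rewrite tensorDl.
- by rewrite linearD tensorDr.
- by rewrite linearZ /= tensor_bal.
Qed.

Lemma tens_map_tensor (S R : pzRingType) (A : bimod S R) (B B' : lmodType R)
    (g : {linear B -> B'}) a b :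
  tens_map g (tensor a b : tens A B) = tensor a (g b).
Proof. by rewrite /tens_map tliftE //; exact: tens_map_bal. Qed.

(* Direct sums: families of finite support *)
Section DirectSum.
Variables (P : choiceType) (F : P -> zmodType).

Record dsum := DSum {
  dcoef :> forall p, F p;
  dcoefP : finite_set [set p | dcoef p != 0] }.

Lemma dsum_eq (f g : dsum) : (forall p, f p = g p) -> f = g.
Proof.
case: f g => [f fP] [g gP] /= fg.
have {}fg : f = g by apply: functional_extensionality_dep.
by case: _ / fg gP => gP; rewrite (Prop_irrelevance fP gP).
Qed.

HB.instance Definition _ := gen_eqMixin dsum.
HB.instance Definition _ := gen_choiceMixin dsum.

Fact dsum0_fin : finite_set [set p | (0 : F p) != 0].
Proof.
by apply: (sub_finite_set _ (finite_set0 P)) => p /=; rewrite eqxx.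
Qed.
Definition dsum0 : dsum := DSum dsum0_fin.

Fact dsum_opp_fin (f : dsum) : finite_set [set p | - f p != 0].
Proof.
by apply: (sub_finite_set _ (dcoefP f)) => p /=; rewrite oppr_eq0.
Qed.
Definition dsum_opp (f : dsum) : dsum := DSum (dsum_opp_fin f).

Fact dsum_add_fin (f g : dsum) : finite_set [set p | f p + g p != 0].
Proof.
apply: (@sub_finite_set _ _ ([set p | f p != 0] `|` [set p | g p != 0])).
  move=> p /=; have [->|] := eqVneq (f p) 0; last by left.
  by rewrite add0r; right.
by rewrite finite_setU; split; apply: dcoefP.
Qed.
Definition dsum_add (f g : dsum) : dsum := DSum (dsum_add_fin f g).

Fact dsum_addA : associative dsum_add.
Proof. by move=> f g h; apply: dsum_eq => p /=; rewrite addrA. Qed.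
Fact dsum_addC : commutative dsum_add.
Proof. by move=> f g; apply: dsum_eq => p /=; rewrite addrC. Qed.
Fact dsum_add0 : left_id dsum0 dsum_add.
Proof. by move=> f; apply: dsum_eq => p /=; rewrite add0r. Qed.
Fact dsum_addN : left_inverse dsum0 dsum_opp dsum_add.
Proof. by move=> f; apply: dsum_eq => p /=; rewrite addNr. Qed.

HB.instance Definition _ :=
  GRing.isZmodule.Build dsum dsum_addA dsum_addC dsum_add0 dsum_addN.

Lemma dsumDE (f g : dsum) p : (f + g) p = f p + g p. Proof. by []. Qed.
Lemma dsum0E p : (0 : dsum) p = 0. Proof. by []. Qed.

Lemma dsum_sumE (J : Type) (s : seq J) (Q : pred J) (G : J -> dsum) p :
  (\sum_(j <- s | Q j) G j) p = \sum_(j <- s | Q j) G j p.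
Proof. exact: (big_morph (fun f : dsum => f p) (fun _ _ => erefl) erefl). Qed.

Definition dinj_coef p (x : F p) q : F q :=
  if p =P q is ReflectT e then ecast q (F q) e x else 0.
Fact dinj_fin p (x : F p) : finite_set [set q | dinj_coef x q != 0].
Proof.
apply: (sub_finite_set _ (finite_set1 p)) => q /=; rewrite /dinj_coef.
by case: eqP => [e _|_]; rewrite ?eqxx.
Qed.
Definition dinj p (x : F p) : dsum := DSum (dinj_fin x).

Lemma dinjE p (x : F p) : dinj x p = x.
Proof. by rewrite /= /dinj_coef; case: eqP => // e; rewrite eq_axiomK. Qed.

Lemma dinj_neq p q (x : F p) : p != q -> dinj x q = 0.
Proof. by rewrite /= /dinj_coef; case: eqP. Qed.

Lemma dinjD p (x y : F p) : dinj (x + y) = dinj x + dinj y.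
Proof.
apply: dsum_eq => q; rewrite dsumDE; have [<-|pq] := eqVneq p q.
  by rewrite !dinjE.
by rewrite !dinj_neq // addr0.
Qed.

Lemma dsum_supp (f : dsum) p :
  p \notin fset_set [set p | f p != 0] -> f p = 0.
Proof.
rewrite in_fset_set; last exact: dcoefP.
by move=> /negP/contra_notP; apply; move=> /eqP fp; rewrite inE.
Qed.

Lemma dsum_expand (f : dsum) :
  f = \sum_(p <- fset_set [set p | f p != 0]) dinj (f p).
Proof.
apply: dsum_eq => q; rewrite dsum_sumE.
have [qf|qf] := boolP (q \in fset_set [set p | f p != 0]).
  rewrite (bigD1_seq q qf (fset_uniq _)) dinjE.
  by rewrite big1 => [/=|p pq]; rewrite ?addr0 // dinj_neq.
rewrite (dsum_supp qf) big_seq big1 // => p pf; apply: dinj_neq.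
by apply: contraNneq qf => <-.
Qed.

Lemma dsum_ind (Q : dsum -> Prop) :
  Q 0 -> (forall f g, Q f -> Q g -> Q (f + g)) ->
  (forall p x, Q (dinj (p := p) x)) -> forall f, Q f.
Proof.
move=> Q0 QD Qi f; rewrite (dsum_expand f).
by elim/big_rec: _ => // p g _; apply: QD.
Qed.

(* the map out of the direct sum with components beta *)
Definition dlift (Z : zmodType) (beta : forall p, F p -> Z) (f : dsum) : Z :=
  \sum_(p \in [set: P]) beta p (f p).

Lemma dliftD (Z : zmodType) (beta : forall p, F p -> Z) :
  (forall p, additive_fun (@beta p)) -> additive_fun (dlift beta).
Proof.
move=> bD f g; rewrite /dlift.
pose X := (fset_set [set p | f p != 0%R] `|`
           fset_set [set p | g p != 0%R])%fset.
have fX p : p \notin X -> f p = 0.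
  by rewrite inE negb_or => /andP[/dsum_supp].
have gX p : p \notin X -> g p = 0.
  by rewrite inE negb_or => /andP[_ /dsum_supp].
have b0 p : beta p 0 = 0 by exact: additive_fun0.
rewrite (fsbigTE X) => [|p pX]; last by rewrite dsumDE fX // gX // addr0.
rewrite [Y in _ = Y + _](fsbigTE X) => [|p pX]; last by rewrite fX.
rewrite [Y in _ = _ + Y](fsbigTE X) => [|p pX]; last by rewrite gX.
by rewrite -big_split /=; apply: eq_bigr => p _; rewrite bD.
Qed.

Lemma dlift_inj (Z : zmodType) (beta : forall p, F p -> Z) p (x : F p) :
  (forall p, additive_fun (@beta p)) -> dlift beta (dinj x) = beta p x.
Proof.
move=> bD; rewrite /dlift (fsbigTE [fset p]%fset) => [|q].
  by rewrite big_seq_fset1 dinjE.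
by rewrite inE eq_sym => pq; rewrite dinj_neq // additive_fun0.
Qed.

Fact dmap_fin (F' : P -> zmodType) (g : forall p, F p -> F' p)
    (g0 : forall p, g p 0 = 0) (f : dsum) :
  finite_set [set p | g p (f p) != 0].
Proof.
apply: (sub_finite_set _ (dcoefP f)) => p /=.
by apply: contra_neq => ->; apply: g0.
Qed.

End DirectSum.

Section DirectSumBimod.
Variables (S R : pzRingType) (P : choiceType) (F : P -> bimod S R).

Definition dsum_bimod_car := dsum (fun p => F p : zmodType).
HB.instance Definition _ := GRing.Zmodule.on dsum_bimod_car.

Definition dsum_scale (s : S) (f : dsum_bimod_car) : dsum_bimod_car :=
  DSum (dmap_fin (F' := fun p => F p : zmodType) (g := fun p x => s *: x)
          (fun p => scaler0 _ s) f).

Fact dsum_scaleA s t f : dsum_scale s (dsum_scale t f) = dsum_scale (s * t) f.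
Proof. by apply: dsum_eq => p /=; rewrite scalerA. Qed.
Fact dsum_scale1 : left_id 1 dsum_scale.
Proof. by move=> f; apply: dsum_eq => p /=; rewrite scale1r. Qed.
Fact dsum_scaleDr : right_distributive dsum_scale +%R.
Proof. by move=> s f g; apply: dsum_eq => p /=; rewrite scalerDr. Qed.
Fact dsum_scaleDl f : {morph dsum_scale^~ f : s t / s + t}.
Proof. by move=> s t; apply: dsum_eq => p /=; rewrite scalerDl. Qed.
HB.instance Definition _ := GRing.Zmodule_isLmodule.Build S dsum_bimod_car
  dsum_scaleA dsum_scale1 dsum_scaleDr dsum_scaleDl.

Fact ract0 (A : bimod S R) r : ract (0 : A) r = 0.
Proof. exact: (@additive_fun0 A A (fun a => ract a r) (fun a b => ractDl a b r)). Qed.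

Definition dsum_ract (f : dsum_bimod_car) (r : R) : dsum_bimod_car :=
  DSum (dmap_fin (F' := fun p => F p : zmodType) (g := fun p x => ract x r)
          (fun p => ract0 (F p) r) f).

Fact dsum_ractDl f g r : dsum_ract (f + g) r = dsum_ract f r + dsum_ract g r.
Proof. by apply: dsum_eq => p /=; rewrite ractDl. Qed.
Fact dsum_ractDr f r t : dsum_ract f (r + t) = dsum_ract f r + dsum_ract f t.
Proof. by apply: dsum_eq => p /=; rewrite ractDr. Qed.
Fact dsum_ractA f r t : dsum_ract (dsum_ract f r) t = dsum_ract f (r * t).
Proof. by apply: dsum_eq => p /=; rewrite ractA. Qed.
Fact dsum_ract1 f : dsum_ract f 1 = f.
Proof. by apply: dsum_eq => p /=; rewrite ract1. Qed.
Fact dsum_ractZ s f r : dsum_ract (s *: f) r = s *: dsum_ract f r.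
Proof. by apply: dsum_eq => p /=; rewrite ractZ. Qed.

Definition dsum_bimod : bimod S R :=
  Bimod dsum_ractDl dsum_ractDr dsum_ractA dsum_ract1 dsum_ractZ.
End DirectSumBimod.

Section TwoSidedIdeal.
Variable R : pzRingType.

Definition two_sided_ideal (J : set R) : Prop :=
  [/\ J 0, forall x y, J x -> J y -> J (x - y),
      forall a x, J x -> J (a * x) & forall x a, J x -> J (x * a)].

Definition gen_ideal (X : set R) : set R := smallest two_sided_ideal X.

Lemma gen_idealP X : two_sided_ideal (gen_ideal X).
Proof.
split=> [J [[]]//|x y Jx Jy J JP|a x Jx J JP|x a Jx J JP].
- by case: (JP) => -[_ JB _ _] _; apply: JB; [exact: Jx|exact: Jy].
- by case: (JP) => -[_ _ JM _] _; apply: JM; exact: Jx.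
- by case: (JP) => -[_ _ _ JM] _; apply: JM; exact: Jx.
Qed.

Variable X : set R.
Let J := gen_ideal X.

Definition gen_ideal_pred : {pred R} := fun x => `[< J x >].

Fact gen_ideal_zmod_closed : zmod_closed gen_ideal_pred.
Proof.
have [J0 JB _ _] := gen_idealP X.
split=> [|x y /asboolP Jx /asboolP Jy]; apply/asboolP => //.
exact: JB.
Qed.
HB.instance Definition _ :=
  GRing.isZmodClosed.Build R gen_ideal_pred gen_ideal_zmod_closed.

(* R / <X>; the additive group is the library's quotient *)
Definition quot_ring := @Quotient.quot R gen_ideal_pred.
HB.instance Definition _ := GRing.Zmodule.on quot_ring.

Definition quot_pi (x : R) : quot_ring := \pi_(@Quotient.quot R gen_ideal_pred) x.

Lemma quot_piP x y : quot_pi x = quot_pi y <-> J (x - y).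
Proof.
split=> [/eqP|Jxy]; first by rewrite -Quotient.idealrBE => /asboolP.
by apply/eqP; rewrite -Quotient.idealrBE; apply/asboolP.
Qed.

Lemma quot_pi_repr (x : quot_ring) : quot_pi (repr x) = x.
Proof. exact: reprK. Qed.

Lemma quot_piD x y : quot_pi (x + y) = quot_pi x + quot_pi y.
Proof. exact: raddfD. Qed.

Definition quot_one : quot_ring := quot_pi 1.
Definition quot_mul (x y : quot_ring) : quot_ring := quot_pi (repr x * repr y).

Lemma quot_piM x y : quot_pi (x * y) = quot_mul (quot_pi x) (quot_pi y).
Proof.
have [J0 JB JMl JMr] := gen_idealP X.
have JN u : J u -> J (- u) by rewrite -sub0r; exact: JB.
have JD u v : J u -> J v -> J (u + v).
  by move=> Ju Jv; rewrite -[v]opprK; apply: JB => //; exact: JN.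
have Jrepr u : J (u - repr (quot_pi u)) by apply/quot_piP; rewrite quot_pi_repr.
apply/quot_piP; set a := repr (quot_pi x); set b := repr (quot_pi y).
have -> : x * y - a * b = x * (y - b) + (x - a) * b.
  by rewrite mulrBr mulrBl addrA subrK.
by apply: JD; [apply: JMl; exact: Jrepr|apply: JMr; exact: Jrepr].
Qed.

Fact quot_mulA : associative quot_mul.
Proof.
move=> x y z; rewrite -[x]quot_pi_repr -[y]quot_pi_repr -[z]quot_pi_repr.
by rewrite -!quot_piM mulrA.
Qed.
Fact quot_mul1l : left_id quot_one quot_mul.
Proof. by move=> x; rewrite -[x]quot_pi_repr -quot_piM mul1r. Qed.
Fact quot_mul1r : right_id quot_one quot_mul.
Proof. by move=> x; rewrite -[x]quot_pi_repr -quot_piM mulr1. Qed.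
Fact quot_mulDl : left_distributive quot_mul +%R.
Proof.
move=> x y z; rewrite -[x]quot_pi_repr -[y]quot_pi_repr -[z]quot_pi_repr.
by rewrite -quot_piD -!quot_piM mulrDl quot_piD.
Qed.
Fact quot_mulDr : right_distributive quot_mul +%R.
Proof.
move=> x y z; rewrite -[x]quot_pi_repr -[y]quot_pi_repr -[z]quot_pi_repr.
by rewrite -quot_piD -!quot_piM mulrDr quot_piD.
Qed.
HB.instance Definition _ := GRing.Zmodule_isPzRing.Build quot_ring
  quot_mulA quot_mul1l quot_mul1r quot_mulDl quot_mulDr.

End TwoSidedIdeal.

Section TensorAlgebra.
Variables (D : pzRingType) (M : bimod D D).

(* [tpowS n] is the (n+1)-fold tensor power of M over D. *)
Fixpoint tpowS (n : nat) : bimod D D :=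
  if n is n'.+1 then tens_bimod M (tpowS n') else M.

Definition tpow (n : nat) : bimod D D :=
  if n is n'.+1 then tpowS n' else regular_bimod D.

Definition tensor_algebra := dsum_bimod_car tpow.
Local Notation T := tensor_algebra.
HB.instance Definition _ := GRing.Lmodule.on T.

Definition tin (n : nat) (x : tpow n) : T := @dinj _ (fun n => tpow n) n x.

(* left multiplication by an element of degree one: on the components,
   D -> M is d |-> m d and M^(n) -> M^(n+1) is t |-> m (x) t *)
Definition tshift_coef (m : M) (f : T) (n : nat) : tpow n :=
  match n return tpow n with
  | 0 => 0
  | 1 => ract m (f 0%N)
  | n'.+2 => tensor m (f n'.+1)
  end.

Lemma tensor0 (S' R : pzRingType) (A : bimod S' R) (B : lmodType R) (a : A) :
  tensor a (0 : B) = 0.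
Proof. by apply: (@additive_fun0 B _ (tensor a)) => b b'; exact: tensorDr. Qed.

Fact tshift_fin m f : finite_set [set n | tshift_coef m f n != 0].
Proof.
apply: (sub_finite_set _ (finite_image S (dcoefP f))) => -[|[|n]] /=.
- by rewrite eqxx.
- move=> mf; exists 0%N => //; apply: contra_neq mf => ->.
  exact: (@additive_fun0 D M (ract m) (ractDr m)).
- by move=> mf; exists n.+1 => //; apply: contra_neq mf => ->; exact: tensor0.
Qed.
Definition tshift (m : M) (f : T) : T := DSum (tshift_fin m f).

(* left multiplication by a homogeneous element; in degree >= 2 it is
   determined by (m (x) t) f = m (t f) *)
Fixpoint tactS (n : nat) : tpowS n -> T -> T :=
  match n return tpowS n -> T -> T with
  | 0 => tshift
  | n'.+1 => @tlift D D M (tpowS n') (T -> T) (fun m t => tshift m \o tactS t)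
  end.
Definition tact (n : nat) : tpow n -> T -> T :=
  match n return tpow n -> T -> T with
  | 0 => fun d f => (d : D) *: f
  | n'.+1 => @tactS n'
  end.

Definition tmul (f g : T) : T := dlift (fun n x => tact x g) f.
Definition tone : T := tin (n := 0) (1 : D).

Lemma tshiftDr m : additive_fun (tshift m).
Proof.
move=> f g; apply: dsum_eq => -[|[|n]]; rewrite dsumDE /=.
- by rewrite addr0.
- by rewrite ractDr.
- by rewrite tensorDr.
Qed.

Lemma tshiftDl f : additive_fun (tshift^~ f).
Proof.
move=> m m'; apply: dsum_eq => -[|[|n]]; rewrite dsumDE /=.
- by rewrite addr0.
- by rewrite ractDl.
- by rewrite tensorDl.
Qed.

Lemma tshift_ract m d f : tshift (ract m d) f = tshift m (d *: f).
Proof.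
apply: dsum_eq => -[|[|n]] //=; first by rewrite ractA.
by rewrite tensor_bal.
Qed.

Lemma tshiftZ d m f : tshift (d *: m) f = d *: tshift m f.
Proof.
apply: dsum_eq => -[|[|n]] /=.
- by rewrite scaler0.
- by rewrite ractZ.
- by rewrite tensorZ.
Qed.

Lemma tactS_add_scale n :
  [/\ forall x, additive_fun (@tactS n x), forall f, additive_fun ((@tactS n)^~ f)
   & forall d x f, tactS (n := n) (d *: x) f = d *: tactS x f] /\
  balanced (fun (m : M) (t : tpowS n) => tshift m \o tactS t : T -> T).
Proof.
elim: n => [|n [[IHr IHl IHZ] bal]].
  have h : [/\ forall x, additive_fun (@tactS 0 x),
      forall f, additive_fun ((@tactS 0)^~ f)
    & forall d x f, tactS (n := 0) (d *: x) f = d *: tactS x f].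
    by split; [exact: tshiftDr|exact: tshiftDl|exact: tshiftZ].
  split=> //; split=> [t m m'|m t t'|m d t]; apply/funext => f /=.
  - exact: tshiftDl.
  - by rewrite fctE /= tshiftDl tshiftDr.
  - by rewrite tshiftZ tshift_ract.
have tS m t f : @tactS n.+1 (tensor m t) f = tshift m (tactS t f).
  by rewrite /= tliftE.
have SDl f : additive_fun ((@tactS n.+1)^~ f).
  by move=> x y; rewrite /= tliftD.
have S0 f : @tactS n.+1 0 f = 0.
  exact: (additive_fun0 (SDl f)).
have SDr x : additive_fun (@tactS n.+1 x).
  move=> f g; elim/tens_ind: x => [|x y IHx IHy|m t].
  - by rewrite !S0 addr0.
  - by rewrite !SDl IHx IHy addrACA.
  - by rewrite !tS IHr tshiftDr.
have SZ d x f : @tactS n.+1 (d *: x) f = d *: tactS x f.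
  elim/tens_ind: x => [|x y IHx IHy|m t].
  - by rewrite scaler0 S0 scaler0.
  - by rewrite scalerDr !SDl IHx IHy scalerDr.
  - by rewrite tensorZ !tS tshiftZ.
split=> //; split=> [t m m'|m t t'|m d t]; apply/funext => f.
- exact: tshiftDl.
- by rewrite /comp SDl tshiftDr.
- by rewrite /comp SZ tshift_ract.
Qed.

Lemma tactS_tensor n (m : M) (t : tpowS n) f :
  @tactS n.+1 (tensor m t) f = tshift m (tactS t f).
Proof. by rewrite /= tliftE //; case: (tactS_add_scale n). Qed.

Lemma tactDr n x : additive_fun (@tact n x).
Proof.
case: n x => [|n] x; last by case: (tactS_add_scale n) => -[h _ _] _; exact: h.
by move=> f g; rewrite /tact scalerDr.
Qed.
Lemma tactDl n f : additive_fun ((@tact n)^~ f).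
Proof.
case: n => [|n]; last by case: (tactS_add_scale n) => -[_ h _] _; exact: h.
by move=> x y; rewrite /tact scalerDl.
Qed.
Lemma tactZ n d x f : @tact n (d *: x) f = d *: tact x f.
Proof.
case: n x => [|n] x; last by case: (tactS_add_scale n) => -[_ _ h] _; exact: h.
by rewrite /tact scalerA.
Qed.

Lemma tmul_tin n x g : tmul (tin (n := n) x) g = tact x g.
Proof.
by rewrite /tmul dlift_inj // => p; apply: tactDl.
Qed.

Fact tmulDl : left_distributive tmul +%R.
Proof. by move=> f g h; rewrite /tmul dliftD // => p; apply: tactDl. Qed.

Lemma tmul0 h : tmul 0 h = 0.
Proof.
by apply: (@additive_fun0 T T (tmul^~ h)) => f g; apply: tmulDl.
Qed.

Lemma tmul_ind (Q : T -> Prop) : Q 0 ->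
  (forall f g, Q f -> Q g -> Q (f + g)) ->
  (forall n x, Q (tin (n := n) x)) -> forall f, Q f.
Proof. exact: dsum_ind. Qed.

Fact tmulDr : right_distributive tmul +%R.
Proof.
move=> f g h; elim/tmul_ind: f => [|f f' IH IH'|n x].
- by rewrite !tmul0 addr0.
- by rewrite !tmulDl IH IH' addrACA.
- by rewrite !tmul_tin tactDr.
Qed.

Lemma tmulr0 f : tmul f 0 = 0.
Proof.
by apply: (@additive_fun0 T T (tmul f)) => g h; apply: tmulDr.
Qed.

Fact tmul1l : left_id tone tmul.
Proof. by move=> f; rewrite tmul_tin /tact scale1r. Qed.

Lemma tinD n x y : tin (n := n) (x + y) = tin x + tin y.
Proof. exact: dinjD. Qed.
Lemma tin0 n : tin (n := n) 0 = 0.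
Proof. by apply: (@additive_fun0 (tpow n) T); exact: tinD. Qed.
Lemma tinE n x : tin (n := n) x n = x.
Proof. exact: dinjE. Qed.
Lemma tin_neq n p x : n != p -> tin (n := n) x p = 0.
Proof. exact: dinj_neq. Qed.

Lemma tshift_tin0 m d : tshift m (tin (n := 0) d) = tin (n := 1) (ract m d).
Proof.
apply: dsum_eq => -[|[|n]].
- by rewrite tin_neq.
- by rewrite tinE -[in RHS](tinE (n := 0) d).
- transitivity (tensor m (tin (n := 0) d n.+1)) => //.
  by rewrite !tin_neq //; exact: tensor0.
Qed.

Lemma tshift_tinS m n (t : tpowS n) :
  tshift m (tin (n := n.+1) t) = tin (n := n.+2) (tensor m t).
Proof.
apply: dsum_eq => -[|[|p]].
- by rewrite tin_neq.
- transitivity (ract m (tin (n := n.+1) t 0%N)) => //.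
  rewrite !tin_neq //; exact: (@additive_fun0 D M (ract m) (ractDr m)).
- transitivity (tensor m (tin (n := n.+1) t p.+1)) => //.
  have [<-|np] := eqVneq n p; first by rewrite !tinE.
  by rewrite !tin_neq ?eqSS //; exact: tensor0.
Qed.

Lemma tscale_tin d n x : d *: tin (n := n) x = tin (n := n) (d *: x).
Proof.
apply: dsum_eq => p; transitivity (d *: tin x p) => //.
have [<-|np] := eqVneq n p; first by rewrite !tinE.
by rewrite !tin_neq // scaler0.
Qed.

Lemma tact_tone n x : tact x tone = tin (n := n) x.
Proof.
case: n x => [|n] x.
  by rewrite /tact tscale_tin; congr tin; exact: mulr1.
rewrite /tact; elim: n x => [|n IHn] x.
  by rewrite /= tshift_tin0 ract1.
have SDl := @tactDl n.+2 tone; have S0 := additive_fun0 SDl.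
elim/tens_ind: x => [|x y IHx IHy|m t].
- by rewrite [LHS]S0 tin0.
- by rewrite [LHS]SDl tinD -IHx -IHy.
- by rewrite tactS_tensor IHn tshift_tinS.
Qed.

Fact tmul1r : right_id tone tmul.
Proof.
move=> f; elim/tmul_ind: f => [|f f' IH IH'|n x].
- by rewrite tmul0.
- by rewrite tmulDl IH IH'.
- by rewrite tmul_tin tact_tone.
Qed.

Lemma tscale_tmul d g h : d *: tmul g h = tmul (d *: g) h.
Proof.
elim/tmul_ind: g => [|f f' IH IH'|n x].
- by rewrite scaler0 !tmul0 scaler0.
- by rewrite scalerDr !tmulDl scalerDr IH IH'.
- by rewrite tscale_tin !tmul_tin tactZ.
Qed.

Lemma tshift_tmul m g h : tshift m (tmul g h) = tmul (tshift m g) h.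
Proof.
have s0 : tshift m 0 = 0 by exact: (additive_fun0 (tshiftDr m)).
elim/tmul_ind: g => [|f f' IH IH'|n x].
- by rewrite tmul0 s0 tmul0.
- by rewrite tmulDl !tshiftDr tmulDl IH IH'.
- case: n x => [|n] x.
    by rewrite tshift_tin0 !tmul_tin /= tshift_ract.
  by rewrite tshift_tinS !tmul_tin [RHS]tactS_tensor.
Qed.

Lemma tact_tmul n x g h : @tact n x (tmul g h) = tmul (tact x g) h.
Proof.
case: n x => [|n] x; first exact: tscale_tmul.
elim: n x => [|n IHn] x; first exact: tshift_tmul.
have SDl f := @tactDl n.+2 f; have S0 f := additive_fun0 (SDl f).
elim/tens_ind: x => [|x y IHx IHy|m t].
- by rewrite [LHS]S0 [tact _ _]S0 tmul0.
- by rewrite [LHS]SDl [X in _ = tmul X _]SDl tmulDl IHx IHy.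
- by rewrite /tact !tactS_tensor -tshift_tmul -IHn.
Qed.

Fact tmulA : associative tmul.
Proof.
move=> f g h; elim/tmul_ind: f => [|f f' IH IH'|n x].
- by rewrite !tmul0.
- by rewrite !tmulDl IH IH'.
- by rewrite !tmul_tin tact_tmul.
Qed.

HB.instance Definition _ := GRing.Zmodule_isPzRing.Build T
  tmulA tmul1l tmul1r tmulDl tmulDr.

End TensorAlgebra.

(* [sM j i] is the D_j-D_i-bimodule {}_j M_i; [c%:A] is the image of c in k
   under the structure map k -> D_i. *)
Record species (k : fieldType) (I : Type) := Species {
  sD : I -> falgType k;
  sD_division : forall i (x : sD i), x != 0 -> x \is a GRing.unit;
  sM : forall j i, bimod (sD j) (sD i);
  sM_central : forall j i (c : k) (m : sM j i), c%:A *: m = ract m c%:A;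
  sM_findim : forall j i, exists n (e : 'I_n -> sM j i),
    forall m, exists c : 'I_n -> k, m = \sum_(l < n) (c l)%:A *: e l }.

Section SpeciesAlgebra.
Variables (k : fieldType) (I : finType) (S : species k I).

Definition species_ring := dsum (fun i : I => sD S i : zmodType).
HB.instance Definition _ := GRing.Zmodule.on species_ring.

Fact species_fin (f : forall i : I, sD S i) : finite_set [set i | f i != 0].
Proof. exact: finite_finset. Qed.

Definition sring_one : species_ring := DSum (species_fin (fun=> 1)).
Definition sring_mul (d e : species_ring) : species_ring :=
  DSum (species_fin (fun i => d i * e i)).

Fact sring_mulA : associative sring_mul.
Proof. by move=> d e f; apply: dsum_eq => i /=; rewrite mulrA. Qed.
Fact sring_mul1l : left_id sring_one sring_mul.
Proof. by move=> d; apply: dsum_eq => i /=; rewrite mul1r. Qed.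
Fact sring_mul1r : right_id sring_one sring_mul.
Proof. by move=> d; apply: dsum_eq => i /=; rewrite mulr1. Qed.
Fact sring_mulDl : left_distributive sring_mul +%R.
Proof. by move=> d e f; apply: dsum_eq => i /=; rewrite mulrDl. Qed.
Fact sring_mulDr : right_distributive sring_mul +%R.
Proof. by move=> d e f; apply: dsum_eq => i /=; rewrite mulrDr. Qed.
HB.instance Definition _ := GRing.Zmodule_isPzRing.Build species_ring
  sring_mulA sring_mul1l sring_mul1r sring_mulDl sring_mulDr.

(* the component at p = (j, i) is {}_j M_i *)
Definition species_mod := dsum (fun p : I * I => sM S p.1 p.2 : zmodType).
HB.instance Definition _ := GRing.Zmodule.on species_mod.

Definition smod_scale (d : species_ring) (m : species_mod) : species_mod :=
  DSum (dmap_fin (F' := fun p : I * I => sM S p.1 p.2 : zmodType)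
    (g := fun p x => d p.1 *: x) (fun p => scaler0 _ (d p.1)) m).
Definition smod_ract (m : species_mod) (d : species_ring) : species_mod :=
  DSum (dmap_fin (F' := fun p : I * I => sM S p.1 p.2 : zmodType)
    (g := fun p x => ract x (d p.2)) (fun p => ract0 _ (d p.2)) m).

Fact smod_scaleA d e m : smod_scale d (smod_scale e m) = smod_scale (d * e) m.
Proof. by apply: dsum_eq => p /=; rewrite scalerA. Qed.
Fact smod_scale1 : left_id 1 smod_scale.
Proof. by move=> m; apply: dsum_eq => p /=; rewrite scale1r. Qed.
Fact smod_scaleDr : right_distributive smod_scale +%R.
Proof. by move=> d m n; apply: dsum_eq => p /=; rewrite scalerDr. Qed.
Fact smod_scaleDl m : {morph smod_scale^~ m : d e / d + e}.
Proof. by move=> d e; apply: dsum_eq => p /=; rewrite scalerDl. Qed.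
HB.instance Definition _ := GRing.Zmodule_isLmodule.Build species_ring
  species_mod smod_scaleA smod_scale1 smod_scaleDr smod_scaleDl.

Fact smod_ractDl m n d : smod_ract (m + n) d = smod_ract m d + smod_ract n d.
Proof. by apply: dsum_eq => p /=; rewrite ractDl. Qed.
Fact smod_ractDr m d e : smod_ract m (d + e) = smod_ract m d + smod_ract m e.
Proof. by apply: dsum_eq => p /=; rewrite ractDr. Qed.
Fact smod_ractA m d e : smod_ract (smod_ract m d) e = smod_ract m (d * e).
Proof. by apply: dsum_eq => p /=; rewrite ractA. Qed.
Fact smod_ract1 m : smod_ract m 1 = m.
Proof. by apply: dsum_eq => p /=; rewrite ract1. Qed.
Fact smod_ractZ d m e : smod_ract (d *: m) e = d *: smod_ract m e.
Proof. by apply: dsum_eq => p /=; rewrite ractZ. Qed.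
Definition species_bimod : bimod species_ring species_ring :=
  Bimod smod_ractDl smod_ractDr smod_ractA smod_ract1 smod_ractZ.

Definition species_algebra := tensor_algebra species_bimod.
HB.instance Definition _ := GRing.PzRing.on species_algebra.

End SpeciesAlgebra.

Section Relations.
Variables (k : fieldType) (I : finType) (S : species k I).

Definition arrow (i j : I) : Prop := exists m : sM S j i, m != 0.

(* Paths of length >= 1 in the underlying quiver; elementary tensors of
   relations have at least one factor. *)
Inductive qpath (i : I) : I -> Type :=
| qarrow j : arrow i j -> qpath i j
| qcons j l : qpath i j -> arrow j l -> qpath i l.

HB.instance Definition _ (i j : I) := gen_eqMixin (qpath i j).
HB.instance Definition _ (i j : I) := gen_choiceMixin (qpath i j).

Fixpoint path_tens i j (p : qpath i j) : bimod (sD S j) (sD S i) :=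
  match p with
  | qarrow j _ => sM S j i
  | qcons j l p' _ => tens_bimod (sM S l j) (path_tens p')
  end.

Fixpoint elementary i j (p : qpath i j) : path_tens p -> Prop :=
  match p with
  | qarrow _ _ => fun=> True
  | qcons j l p' _ => fun x => exists (m : sM S l j) (t : path_tens p'),
      x = tensor m t /\ elementary t
  end.

(* {}_j \mathcal{M}_i *)
Definition path_bimod (j i : I) : bimod (sD S j) (sD S i) :=
  dsum_bimod (fun p : qpath i j => path_tens p).

Definition path_in i j (p : qpath i j) (x : path_tens p) : path_bimod j i :=
  @dinj _ (fun p : qpath i j => path_tens p) p x.

Definition is_relation (a b : I) (sigma : path_bimod b a) : Prop :=
  exists n (p : 'I_n -> qpath a b) (g : forall l, path_tens (p l)),
    (forall l, elementary (g l)) /\ sigma = \sum_(l < n) path_in (g l).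

(* {}_j M_i -> M = M^(1) -> T(S) *)
Definition arrow_emb (j i : I) (m : sM S j i) : species_algebra S :=
  @tin _ (species_bimod S) 1
    (@dinj _ (fun p : I * I => sM S p.1 p.2 : zmodType) (j, i) m).

Fixpoint path_emb i j (p : qpath i j) : path_tens p -> species_algebra S :=
  match p with
  | qarrow j _ => fun m => arrow_emb m
  | qcons j l p' _ =>
      tlift (fun (m : sM S l j) (t : path_tens p') => arrow_emb m * path_emb t)
  end.

Definition path_bimod_emb j i : path_bimod j i -> species_algebra S :=
  dlift (fun (p : qpath i j) (x : path_tens p) => path_emb x).

(* [d] placed in the i-th factor of D = \bigoplus_i D_i *)
Let din i (d : sD S i) : species_ring S :=
  @dinj _ (fun i : I => sD S i : zmodType) i d.
Let minj j i (m : sM S j i) : species_mod S :=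
  @dinj _ (fun p : I * I => sM S p.1 p.2 : zmodType) (j, i) m.

Lemma arrow_embD j i : additive_fun (@arrow_emb j i).
Proof. by move=> m m'; rewrite /arrow_emb dinjD tinD. Qed.

Lemma arrow_emb_scale j i d (m : sM S j i) :
  arrow_emb (d *: m) = (din d : species_ring S) *: arrow_emb m.
Proof.
rewrite /arrow_emb tscale_tin; congr tin; apply: dsum_eq => -[j' i'].
transitivity (din d j' *: minj m (j', i')) => //.
have [[<- <-]|ne] := eqVneq (j, i) (j', i'); first by rewrite /din /minj !dinjE.
by rewrite /minj !(dinj_neq _ ne); apply/esym/scaler0.
Qed.

Lemma arrow_emb_ract j i (m : sM S j i) d (x : species_algebra S) :
  arrow_emb (ract m d) * x = arrow_emb m * ((din d : species_ring S) *: x).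
Proof.
have -> : arrow_emb (ract m d) =
    @tin _ (species_bimod S) 1 (@ract _ _ (species_bimod S) (minj m) (din d)).
  rewrite /arrow_emb; congr tin; apply: dsum_eq => -[j' i'].
  transitivity (ract (minj m (j', i')) (din d i')) => //.
  have [[<- <-]|ne] := eqVneq (j, i) (j', i'); first by rewrite /din /minj !dinjE.
  by rewrite /minj !(dinj_neq _ ne); apply/esym/ract0.
rewrite [LHS]tmul_tin [RHS]tmul_tin; exact: tshift_ract.
Qed.

Lemma path_emb_spec i j (p : qpath i j) :
  additive_fun (@path_emb i j p) /\
  forall d (t : path_tens p),
    path_emb (d *: t) = (din d : species_ring S) *: path_emb t.
Proof.
elim: p => {j} [j a|j l p [IHD IHZ] a] /=.
  by split; [exact: arrow_embD|move=> d m; exact: arrow_emb_scale].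
have bal : balanced (fun (m : sM S l j) (t : path_tens p) =>
    arrow_emb m * path_emb t).
  split=> [t m m'|m t t'|m d t].
  - by rewrite arrow_embD mulrDl.
  - by rewrite IHD mulrDr.
  - by rewrite IHZ arrow_emb_ract.
have SD := tliftD bal; have S0 := additive_fun0 SD.
split=> // d; elim/tens_ind => [|x y IHx IHy|m t].
- by rewrite scaler0 !S0 scaler0.
- by rewrite scalerDr !SD IHx IHy scalerDr.
- by rewrite tensorZ !tliftE // arrow_emb_scale; apply/esym/tscale_tmul.
Qed.

Lemma path_emb_tensor i j l (p : qpath i j) (a : arrow j l)
    (m : sM S l j) (t : path_tens p) :
  @path_emb _ _ (qcons p a) (tensor m t) = arrow_emb m * path_emb t.
Proof.
have [D Z] := path_emb_spec p.
rewrite /= tliftE //; split=> [x n n'|n x y|n d x].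
- by rewrite arrow_embD mulrDl.
- by rewrite D mulrDr.
- by rewrite Z arrow_emb_ract.
Qed.

Lemma path_bimod_embE i j (p : qpath i j) (t : path_tens p) :
  path_bimod_emb (path_in t) = path_emb t.
Proof. by apply: dlift_inj => q; case: (path_emb_spec q). Qed.

Definition relation_ideal_gens (rho : forall a b : I, set (path_bimod b a)) :
    set (species_algebra S) :=
  [set x | exists a b, exists2 sigma, rho a b sigma & x = path_bimod_emb sigma].

Definition sub_bimodule (R R' : pzRingType) (A : bimod R R') (N : set A) :=
  [/\ N 0, forall x y, N x -> N y -> N (x - y),
      forall r x, N x -> N (r *: x) & forall x r, N x -> N (ract x r)].

Definition gen_sub_bimodule (R R' : pzRingType) (A : bimod R R') (X : set A) :
  set A := smallest (@sub_bimodule R R' A) X.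

End Relations.

Section Representations.
Variables (k : fieldType) (I : finType) (S : species k I).

Record rep := Rep {
  rspace :> forall i, lmodType (sD S i);
  rmap : forall j i, {linear tens (sM S j i) (rspace i) -> rspace j} }.

Record rep_hom (V W : rep) := RepHom {
  rhom : forall i, {linear V i -> W i};
  rhom_comm : forall j i (x : tens (sM S j i) (V i)),
    rmap W j i (tens_map (rhom i) x) = rhom j (rmap V j i x) }.

Fixpoint path_act (V : rep) i j (p : qpath S i j) : path_tens p -> V i -> V j :=
  match p with
  | qarrow j _ => fun m v => rmap V j i (tensor m v)
  | qcons j l p' _ => fun x v =>
      tlift (fun (m : sM S l j) (t : path_tens p') =>
               rmap V l j (tensor m (path_act t v))) x
  end.

Arguments path_act V [i j p] _ _.

(* {}_j f_i *)
Definition rep_f (V : rep) j i : tens (path_bimod S j i) (V i) -> V j :=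
  tlift (fun (x : path_bimod S j i) v =>
           dlift (fun (p : qpath S i j) (t : path_tens p) => path_act V t v) x).

Lemma path_act_spec (V : rep) i j (p : qpath S i j) :
  [/\ forall v, additive_fun (fun t : path_tens p => path_act V t v),
      forall t : path_tens p, additive_fun (path_act V t),
      forall (t : path_tens p) d (v : V i),
        path_act V (ract t d) v = path_act V t (d *: v)
    & forall (t : path_tens p) d (v : V i),
        path_act V (d *: t) v = d *: path_act V t v].
Proof.
elim: p => {j} [j a|j l p [IHl IHr IHb IHZ] a] /=.
  split=> [v m m'|m v v'|m d v|m d v].
  - by rewrite tensorDl linearD.
  - by rewrite tensorDr linearD.
  - by rewrite tensor_bal.
  - by rewrite -tensorZ linearZ.
have bal v : balanced (fun (m : sM S l j) (t : path_tens p) =>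
               rmap V l j (tensor m (path_act V t v))).
  split=> [t m m'|m t t'|m d t].
  - by rewrite tensorDl linearD.
  - by rewrite IHl tensorDr linearD.
  - by rewrite tensor_bal IHZ.
have SDl v := tliftD (bal v); have S0 v := additive_fun0 (SDl v).
split=> [v|t v v'|t d v|t d v]; first exact: SDl.
- elim/tens_ind: t => [|t t' IH IH'|m t].
  + by rewrite !S0 addr0.
  + by rewrite !SDl IH IH' addrACA.
  + by rewrite !tliftE // IHr tensorDr linearD.
- elim/tens_ind: t => [|t t' IH IH'|m t].
  + by rewrite tens_ract0 !S0.
  + by rewrite tens_ractDl !SDl IH IH'.
  + by rewrite tens_ract_tensor !tliftE // IHb.
- elim/tens_ind: t => [|t t' IH IH'|m t].
  + by rewrite scaler0 !S0 scaler0.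
  + by rewrite scalerDr !SDl IH IH' scalerDr.
  + by rewrite tensorZ !tliftE // -tensorZ linearZ.
Qed.

Lemma rep_fE (V : rep) j i (p : qpath S i j) (t : path_tens p) (v : V i) :
  rep_f (tensor (path_in t) v) = path_act V t v.
Proof.
have aD v' : forall p : qpath S i j,
    additive_fun (fun t : path_tens p => path_act V t v').
  by move=> q; case: (path_act_spec V q).
rewrite /rep_f tliftE; first by rewrite dlift_inj //; exact: aD.
split=> [v' x y|x v1 v2|x d v']; first exact: (dliftD (aD v')).
- move: x; apply: dsum_ind => [|x y IH IH'|q x].
  + by rewrite !(additive_fun0 (dliftD (aD _))) addr0.
  + by rewrite !(dliftD (aD _)) IH IH' addrACA.
  + rewrite !dlift_inj; try exact: aD.
    by case: (path_act_spec V q) => _ h _ _; apply: h.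
- transitivity (dlift (fun (p : qpath S i j) (t : path_tens p) =>
      path_act V t v') (dsum_ract x d)) => //.
  move: x; apply: dsum_ind => [|x y IH IH'|q x].
  + have -> : dsum_ract (0 : path_bimod S j i) d = 0.
      by apply: dsum_eq => q /=; rewrite ract0.
    by rewrite !(additive_fun0 (dliftD (aD _))).
  + by rewrite dsum_ractDl !(dliftD (aD _)) IH IH'.
  + have -> : dsum_ract (path_in x) d = path_in (ract x d).
      apply: dsum_eq => r /=; rewrite /dinj_coef; case: eqP => [e|_].
        by case: _ / e.
      exact: ract0.
    rewrite !dlift_inj; try exact: aD.
    by case: (path_act_spec V q) => _ _ h _; apply: h.
Qed.

(* f vanishes on the image of N (x) V_a, which is spanned by the n (x) v *)
Definition satisfies (rho : forall a b : I, set (path_bimod S b a)) (V : rep) :=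
  forall a b (sigma : path_bimod S b a), rho a b sigma ->
  forall (n : path_bimod S b a) (v : V a), gen_sub_bimodule [set sigma] n ->
  rep_f (tensor n v) = 0.

End Representations.

Record category := Category {
  obj :> Type;
  hom : obj -> obj -> Type;
  idc : forall x, hom x x;
  compc : forall x y z, hom y z -> hom x y -> hom x z;
  comp1c : forall x y (f : hom x y), compc (idc y) f = f;
  compc1 : forall x y (f : hom x y), compc f (idc x) = f;
  compcA : forall w x y z (f : hom y z) (g : hom x y) (h : hom w x),
    compc f (compc g h) = compc (compc f g) h }.

Record functor (C D : category) := Functor {
  fobj :> C -> D;
  fhom : forall x y, hom x y -> hom (fobj x) (fobj y);
  fhom1 : forall x, fhom (idc x) = idc (fobj x);
  fhomM : forall x y z (f : hom y z) (g : hom x y),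
    fhom (compc f g) = compc (fhom f) (fhom g) }.

Definition functor_id (C : category) : functor C C :=
  @Functor C C id (fun x y f => f) (fun x => erefl) (fun x y z f g => erefl).

Section FunctorComp.
Variables (C D E : category) (G : functor D E) (F : functor C D).
Fact functor_comp1 x : fhom G (fhom F (idc x)) = idc (G (F x)).
Proof. by rewrite !fhom1. Qed.
Fact functor_compM x y z (f : hom y z) (g : hom x y) :
  fhom G (fhom F (compc f g)) = compc (fhom G (fhom F f)) (fhom G (fhom F g)).
Proof. by rewrite !fhomM. Qed.
Definition functor_comp : functor C E :=
  @Functor C E (fun x => G (F x)) (fun x y f => fhom G (fhom F f))
    functor_comp1 functor_compM.
End FunctorComp.

Definition is_isoc (C : category) (x y : C) (f : hom x y) : Prop :=
  exists g : hom y x, compc g f = idc x /\ compc f g = idc y.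

Definition naturally_isomorphic (C D : category) (F G : functor C D) : Prop :=
  exists eta : forall x, hom (F x) (G x),
    (forall x y (f : hom x y),
       compc (eta y) (fhom F f) = compc (fhom G f) (eta x)) /\
    (forall x, is_isoc (eta x)).

Definition equivalent_categories (C D : category) : Prop :=
  exists (F : functor C D) (G : functor D C),
    naturally_isomorphic (functor_comp G F) (functor_id C) /\
    naturally_isomorphic (functor_comp F G) (functor_id D).

Lemma linear_eq (R : pzRingType) (U V : lmodType R) (f g : {linear U -> V}) :
  f =1 g -> f = g.
Proof.
case: f g => f cf [g cg] /= /funext e; case: _ / e cg => cg.
congr GRing.Linear.Pack; case: cf cg => [[a] [b]] [[c] [d]].
by rewrite (Prop_irrelevance a c) (Prop_irrelevance b d).
Qed.

Section ModuleCategory.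
Variable R : pzRingType.
Definition lin_id (U : lmodType R) : {linear U -> U} := idfun.
Definition lin_comp (U V W : lmodType R) (f : {linear V -> W})
    (g : {linear U -> V}) : {linear U -> W} := f \o g.
Fact lin_comp1c (U V : lmodType R) (f : {linear U -> V}) :
  lin_comp (lin_id V) f = f.
Proof. exact: linear_eq. Qed.
Fact lin_compc1 (U V : lmodType R) (f : {linear U -> V}) :
  lin_comp f (lin_id U) = f.
Proof. exact: linear_eq. Qed.
Fact lin_compA (T U V W : lmodType R) (f : {linear V -> W})
    (g : {linear U -> V}) (h : {linear T -> U}) :
  lin_comp f (lin_comp g h) = lin_comp (lin_comp f g) h.
Proof. exact: linear_eq. Qed.
Definition Mod : category :=
  Category lin_comp1c lin_compc1 lin_compA.
End ModuleCategory.

Lemma tens_map_id (S R : pzRingType) (A : bimod S R) (B : lmodType R)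
    (x : tens A B) : tens_map (lin_id B) x = x.
Proof.
have D := tliftD (tens_map_bal A (lin_id B)).
elim/tens_ind: x => [|x y IHx IHy|a b]; first exact: (additive_fun0 D).
- by rewrite [LHS]D -[in RHS]IHx -[in RHS]IHy.
- by rewrite tens_map_tensor.
Qed.

Lemma tens_map_comp (S R : pzRingType) (A : bimod S R) (B B' B'' : lmodType R)
    (f : {linear B' -> B''}) (g : {linear B -> B'}) (x : tens A B) :
  tens_map (lin_comp f g) x = tens_map f (tens_map g x).
Proof.
have Dfg := tliftD (tens_map_bal A (lin_comp f g)).
have Df := tliftD (tens_map_bal A f); have Dg := tliftD (tens_map_bal A g).
elim/tens_ind: x => [|x y IHx IHy|a b].
- rewrite [LHS](additive_fun0 Dfg) [tens_map g 0](additive_fun0 Dg).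
  by rewrite [RHS](additive_fun0 Df).
- rewrite [LHS]Dfg [tens_map g _]Dg [RHS]Df.
  exact: (congr2 +%R IHx IHy).
- by rewrite !tens_map_tensor.
Qed.

Section RepCategory.
Variables (k : fieldType) (I : finType) (S : species k I).

Lemma rep_hom_eq (V W : rep S) (f g : rep_hom V W) :
  (forall i, rhom f i =1 rhom g i) -> f = g.
Proof.
case: f g => f fP [g gP] /= fg.
have e : f = g by apply: functional_extensionality_dep => i; exact/linear_eq/fg.
by case: _ / e gP => gP; rewrite (Prop_irrelevance fP gP).
Qed.

Fact rep_id_comm (V : rep S) j i (x : tens (sM S j i) (V i)) :
  rmap V j i (tens_map (lin_id (V i)) x) = lin_id (V j) (rmap V j i x).
Proof. by rewrite tens_map_id. Qed.
Definition rep_id (V : rep S) : rep_hom V V := RepHom (@rep_id_comm V).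

Fact rep_comp_comm (U V W : rep S) (f : rep_hom V W) (g : rep_hom U V) j i
    (x : tens (sM S j i) (U i)) :
  rmap W j i (tens_map (lin_comp (rhom f i) (rhom g i)) x) =
  lin_comp (rhom f j) (rhom g j) (rmap U j i x).
Proof. by rewrite tens_map_comp !rhom_comm. Qed.
Definition rep_comp (U V W : rep S) (f : rep_hom V W) (g : rep_hom U V) :
  rep_hom U W := RepHom (rep_comp_comm f g).

Variable rho : forall a b : I, set (path_bimod S b a).
Let ob := {V : rep S | satisfies rho V}.
Let hm (V W : ob) := rep_hom (sval V) (sval W).

Fact rep_comp1c (V W : ob) (f : hm V W) : rep_comp (rep_id _) f = f.
Proof. exact: rep_hom_eq. Qed.
Fact rep_compc1 (V W : ob) (f : hm V W) : rep_comp f (rep_id _) = f.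
Proof. exact: rep_hom_eq. Qed.
Fact rep_compA (T U V W : ob) (f : hm V W) (g : hm U V) (h : hm T U) :
  rep_comp f (rep_comp g h) = rep_comp (rep_comp f g) h.
Proof. exact: rep_hom_eq. Qed.

(* the full subcategory on the representations satisfying rho *)
Definition RepCat : category :=
  @Category ob hm (fun V => rep_id (sval V))
    (fun U V W (f : hm V W) (g : hm U V) => rep_comp f g)
    rep_comp1c rep_compc1 rep_compA.
End RepCategory.

(* Main.v *)
(* A representation V yields the T(S)-module (+)_i V_i, on which D acts
   componentwise and M through the maps of V.  Writing e_i for the identity of
   D_i in T(S), multiplication by a tensor along a path from i to j is the
   corresponding composite of maps of V precomposed with e_i and placed in
   V_j; so <rho> annihilates the module as soon as V satisfies rho.
   The resulting functor is fully faithful because a T(S)-linear map commutes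
   with the e_i, hence respects the summands.  It is essentially surjective
   because 1 = sum_i e_i splits any module W as (+)_i e_i W. *)

From HB Require Import structures.
From mathcomp Require Import all_boot all_algebra falgebra.
From mathcomp Require Import all_classical.
Require Import Defs.

Set Implicit Arguments.
Unset Strict Implicit.
Unset Printing Implicit Defensive.

Import GRing.Theory.
Local Open Scope classical_set_scope.
Local Open Scope ring_scope.

(** * Fully faithful, essentially surjective functors *)

Section FullyFaithful.
Variables (C D : category) (F : functor C D).
Hypothesis F_full : forall (x y : C) (f : hom (F x) (F y)),
  exists g, fhom F g = f.
Hypothesis F_faithful : forall (x y : C) (f g : hom x y),
  fhom F f = fhom F g -> f = g.
Hypothesis F_esssurj : forall y : D, exists x (f : hom (F x) y), is_isoc f.

(** The inverse functor comes from choice: each [y] gets an object whose image is isomorphic to it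
    through [e y]. The [e y] form one of the two natural isomorphisms, and the lifts of the
    [e (F x)] form the other. *)
Theorem fully_faithful_equivalence : equivalent_categories C D.
Proof.
pose lift (x y : C) (f : hom (F x) (F y)) : hom x y := sval (cid (F_full f)).
have liftK x y (f : hom (F x) (F y)) : fhom F (lift x y f) = f.
  by rewrite /lift; case: cid.
(* Object, isomorphism and inverse are packed into one dependent pair, so that a single choice for
   each [y] fixes all three. *)
have gE y : exists z : {x : C & hom (F x) y * hom y (F x)}%type,
    compc (tagged z).2 (tagged z).1 = idc (F (tag z)) /\
    compc (tagged z).1 (tagged z).2 = idc y.
  have [x [f [h [hf fh]]]] := F_esssurj y.
  by exists (Tagged (fun x : C => hom (F x) y * hom y (F x))%type (f, h)).
pose g y := sval (cid (gE y)); have gP y := svalP (cid (gE y)).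
pose G0 y := tag (g y); pose e y : hom (F (G0 y)) y := (tagged (g y)).1.
pose e' y : hom y (F (G0 y)) := (tagged (g y)).2.
have e'e y : compc (e' y) (e y) = idc _ by case: (gP y).
have ee' y : compc (e y) (e' y) = idc _ by case: (gP y).
(* Conjugate [f] by the chosen isomorphisms and lift through [F]; since lifts are unique by
   faithfulness, [G1] is functorial. *)
pose G1 x y (f : hom x y) := lift (G0 x) (G0 y) (compc (e' y) (compc f (e x))).
have G11 y : G1 y y (idc y) = idc (G0 y).
  by apply: F_faithful; rewrite liftK fhom1 comp1c.
have G1M x y z (f : hom y z) (h : hom x y) :
    G1 x z (compc f h) = compc (G1 y z f) (G1 x y h).
  apply: F_faithful; rewrite fhomM !liftK -!compcA; congr compc.
  by congr compc; rewrite !compcA ee' comp1c.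
pose G := @Functor D C G0 G1 G11 G1M; exists F, G; split.
- pose eta x : hom (G (F x)) x := lift _ _ (e (F x)).
  exists eta; split=> [x y f|x].
    by apply: F_faithful; rewrite !fhomM !liftK !compcA ee' comp1c.
  exists (lift _ _ (e' (F x))); split; apply: F_faithful.
    by rewrite fhomM !liftK e'e fhom1.
  by rewrite fhomM !liftK ee' fhom1.
- exists e; split=> [x y f|y]; last first.
    by exists (e' y); split; [exact: e'e|exact: ee'].
  by rewrite /= liftK !compcA ee' comp1c.
Qed.
End FullyFaithful.

(* HB cannot attach a mixin to the carrier of a [zmodType] variable, only to a
   named type. *)
Definition zcarrier (U : zmodType) : Type := U.
HB.instance Definition _ (U : zmodType) := GRing.Zmodule.on (zcarrier U).

(** * Modules from actions, and descent to a quotient ring *)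

Section LmodOfAct.
Variables (R : pzRingType) (U : zmodType) (act : R -> U -> U).
Hypotheses (actA : forall a b u, act a (act b u) = act (a * b) u)
  (act1 : forall u, act 1 u = u) (actDr : forall a, additive_fun (act a))
  (actDl : forall u, additive_fun (act^~ u)).

Let lmod_mixin :=
  GRing.Zmodule_isLmodule.Build R (zcarrier U) actA act1 actDr actDl.
Definition lmod_of_act : lmodType R := HB.pack (zcarrier U) lmod_mixin.
End LmodOfAct.

Section QuotientModule.
Variables (R : pzRingType) (X : set R) (U : lmodType R).
Hypothesis X_kills : forall x u, X x -> x *: (u : U) = 0.

(** The annihilator of [U] is a two-sided ideal containing [X], hence contains the smallest one. *)
Lemma gen_ideal_kills x (u : U) : gen_ideal X x -> x *: u = 0.
Proof.
move=> Xx; suff: [set x : R | forall u : U, x *: u = 0] x by apply.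
apply: Xx; split=> [|y Xy v]; last exact: X_kills.
split=> [v|y z /= hy hz v|a y /= hy v|y a /= hy v].
- exact: scale0r.
- by rewrite scalerBl hy hz subrr.
- by rewrite -scalerA hy scaler0.
- by rewrite -scalerA hy.
Qed.

Definition quot_act (x : quot_ring X) (u : U) := repr x *: u.

(** The action does not depend on the representative: two of them differ by an element of the
    generated ideal, which kills [U]. *)
Lemma quot_act_pi x u : quot_act (quot_pi X x) u = x *: u.
Proof.
apply/eqP; rewrite -subr_eq0 -scalerBl; apply/eqP/gen_ideal_kills/quot_piP.
exact: quot_pi_repr.
Qed.

Fact quot_actA a b u : quot_act a (quot_act b u) = quot_act (a * b) u.
Proof.
rewrite -[a]quot_pi_repr -[b]quot_pi_repr -[_ * _]quot_piM.
by rewrite !quot_act_pi scalerA.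
Qed.
Fact quot_act1 u : quot_act 1 u = u.
Proof. by rewrite [LHS]quot_act_pi scale1r. Qed.
Fact quot_actDr a : additive_fun (quot_act a).
Proof. by move=> u v; rewrite /quot_act scalerDr. Qed.
Fact quot_actDl u : additive_fun (quot_act^~ u).
Proof.
move=> a b; rewrite -[a]quot_pi_repr -[b]quot_pi_repr -quot_piD.
by rewrite !quot_act_pi scalerDl.
Qed.

Definition quot_module : lmodType (quot_ring X) :=
  lmod_of_act quot_actA quot_act1 quot_actDr quot_actDl.

Lemma quot_moduleE x (u : quot_module) : quot_pi X x *: u = x *: (u : U).
Proof. exact: quot_act_pi. Qed.
End QuotientModule.

(** * Modules over a tensor algebra from a linear map $M \otimes_D U \to U$ *)

Section TensorAlgebraModule.
Variables (D : pzRingType) (M : bimod D D) (U : lmodType D) (phi : M -> U -> U).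
Hypothesis phi_bal : balanced phi.
Hypothesis phiZ : forall d m u, phi (d *: m) u = d *: phi m u.

(** An elementary tensor $m_1 \otimes \cdots \otimes m_r$ acts as the composite of the [phi] of its
    factors, the last factor being applied first. *)
Fixpoint tpowS_act (n : nat) : tpowS M n -> U -> U :=
  match n return tpowS M n -> U -> U with
  | 0 => phi
  | n'.+1 => fun x u =>
      tlift (fun (m : M) (t : tpowS M n') => phi m (tpowS_act t u)) x
  end.

Definition tpow_act (n : nat) : tpow M n -> U -> U :=
  match n return tpow M n -> U -> U with
  | 0 => fun d u => (d : D) *: u
  | n'.+1 => @tpowS_act n'
  end.

(** The four properties need a joint induction: additivity and [D]-homogeneity in degree [n] give
    balancedness, which is what allows the lift in the next degree to be evaluated. *)
Lemma tpowS_act_spec n :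
  [/\ forall x, additive_fun (@tpowS_act n x),
      forall u, additive_fun ((@tpowS_act n)^~ u),
      forall d x u, tpowS_act (n := n) (d *: x) u = d *: tpowS_act x u
    & forall u,
        balanced (fun (m : M) (t : tpowS M n) => phi m (tpowS_act t u))].
Proof.
have [phiDl phiDr phiB] := phi_bal.
have bal n' : (forall u, additive_fun ((@tpowS_act n')^~ u)) ->
    (forall d x u, tpowS_act (n := n') (d *: x) u = d *: tpowS_act x u) ->
    forall u, balanced (fun (m : M) (t : tpowS M n') => phi m (tpowS_act t u)).
  move=> hD hZ u; split=> [t m m'|m t t'|m d t].
  - exact: phiDl.
  - by rewrite hD phiDr.
  - by rewrite hZ phiB.
elim: n => [|n [IHr IHl IHZ IHb]]; first by split=> //; exact: (bal 0%N).
have SDl u : additive_fun ((@tpowS_act n.+1)^~ u) by exact: tliftD.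
have S0 u : @tpowS_act n.+1 0 u = 0 := additive_fun0 (SDl u).
have S1 u (m : M) (t : tpowS M n) :
    @tpowS_act n.+1 (tensor m t) u = phi m (tpowS_act t u) by exact: tliftE.
have SZ d x u : @tpowS_act n.+1 (d *: x) u = d *: tpowS_act x u.
  elim/tens_ind: x => [|x y IHx IHy|m t].
  - by rewrite scaler0 S0 scaler0.
  - by rewrite scalerDr !SDl IHx IHy scalerDr.
  - by rewrite tensorZ !S1 phiZ.
split=> //; last exact: bal.
move=> x u v; elim/tens_ind: x => [|x y IHx IHy|m t].
- by rewrite !S0 addr0.
- by rewrite !SDl IHx IHy addrACA.
- by rewrite !S1 IHr phiDr.
Qed.

Lemma tpowS_act_tensor n (m : M) (t : tpowS M n) u :
  @tpowS_act n.+1 (tensor m t) u = phi m (tpowS_act t u).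
Proof. by rewrite /= tliftE //; case: (tpowS_act_spec n). Qed.

Lemma tpow_actDr n x : additive_fun (@tpow_act n x).
Proof.
case: n x => [|n] x; first by move=> u v; rewrite /tpow_act scalerDr.
by case: (tpowS_act_spec n) => h _ _ _; exact: h.
Qed.

Lemma tpow_actDl n u : additive_fun ((@tpow_act n)^~ u).
Proof.
case: n => [|n]; first by move=> x y; rewrite /tpow_act scalerDl.
by case: (tpowS_act_spec n) => _ h _ _; exact: h.
Qed.

Lemma tpow_actZ n d x u : @tpow_act n (d *: x) u = d *: tpow_act x u.
Proof.
case: n x => [|n] x; first by rewrite /tpow_act scalerA.
by case: (tpowS_act_spec n) => _ _ h _; exact: h.
Qed.

Definition talg_act (f : tensor_algebra M) (u : U) : U :=
  dlift (fun n (x : tpow M n) => tpow_act x u) f.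

Lemma talg_act_tin n (x : tpow M n) u : talg_act (tin x) u = tpow_act x u.
Proof. by rewrite /talg_act dlift_inj // => p; exact: tpow_actDl. Qed.

Lemma talg_actDl u : additive_fun (talg_act^~ u).
Proof. by apply: dliftD => p; exact: tpow_actDl. Qed.

Lemma talg_act0 u : talg_act 0 u = 0.
Proof. exact: (additive_fun0 (talg_actDl u)). Qed.

Lemma talg_actDr f : additive_fun (talg_act f).
Proof.
move=> u v; elim/tmul_ind: f => [|f f' IH IH'|n x].
- by rewrite !talg_act0 addr0.
- by rewrite !talg_actDl IH IH' addrACA.
- by rewrite !talg_act_tin tpow_actDr.
Qed.

Lemma talg_actZ d f u : talg_act (d *: f) u = d *: talg_act f u.
Proof.
elim/tmul_ind: f => [|f f' IH IH'|n x].
- by rewrite scaler0 talg_act0 scaler0.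
- by rewrite scalerDr !talg_actDl IH IH' scalerDr.
- by rewrite tscale_tin !talg_act_tin tpow_actZ.
Qed.

(** The shift is left multiplication by [m] in degree one. On degree zero the identity is
    balancedness over [D], on higher degrees it is the recursion for [tpowS_act]. Compatibility with
    all products follows by peeling off one tensor factor at a time. *)
Lemma talg_act_tshift m f u : talg_act (tshift m f) u = phi m (talg_act f u).
Proof.
have [phiDl phiDr phiB] := phi_bal.
have s0 : tshift m (0 : tensor_algebra M) = 0.
  exact: (additive_fun0 (tshiftDr m)).
elim/tmul_ind: f => [|f f' IH IH'|[|n] x].
- by rewrite s0 !talg_act0 (additive_fun0 (phiDr m)).
- by rewrite tshiftDr !talg_actDl IH IH' phiDr.
- by rewrite tshift_tin0 !talg_act_tin [LHS]phiB.
- by rewrite tshift_tinS !talg_act_tin [LHS]tpowS_act_tensor.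
Qed.

Lemma talg_act_tact n (x : tpow M n) f u :
  talg_act (tact x f) u = tpow_act x (talg_act f u).
Proof.
case: n x => [|n] x; first exact: talg_actZ.
elim: n x => [|n IHn] x; first exact: talg_act_tshift.
elim/tens_ind: x => [|x y IHx IHy|m t].
- rewrite (additive_fun0 (@tpow_actDl n.+2 _)).
  by rewrite (additive_fun0 (@tactDl _ _ n.+2 _)) talg_act0.
- by rewrite [LHS](congr1 (talg_act^~ u) (@tactDl _ _ n.+2 _ _ _)) talg_actDl
    IHx IHy [RHS](@tpow_actDl n.+2).
- rewrite /tact tactS_tensor talg_act_tshift [RHS]tpowS_act_tensor.
  congr phi; exact: IHn.
Qed.

Fact talg_actA f g u : talg_act f (talg_act g u) = talg_act (f * g) u.
Proof.
elim/tmul_ind: f => [|f f' IH IH'|n x].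
- by rewrite mul0r !talg_act0.
- by rewrite mulrDl !talg_actDl IH IH'.
- by rewrite talg_act_tin [X in _ = talg_act X _]tmul_tin talg_act_tact.
Qed.

Fact talg_act1 u : talg_act 1 u = u.
Proof. by rewrite [LHS]talg_act_tin /tpow_act scale1r. Qed.

Definition tensor_module : lmodType (tensor_algebra M) :=
  lmod_of_act talg_actA talg_act1 talg_actDr talg_actDl.

Lemma tensor_module_tin0 d (u : tensor_module) :
  tin (M := M) (n := 0) d *: u = (d : D) *: (u : U).
Proof. exact: talg_act_tin. Qed.

Lemma tensor_module_tin1 m (u : tensor_module) :
  tin (n := 1) m *: u = phi m u.
Proof. exact: talg_act_tin. Qed.

End TensorAlgebraModule.

(** * Generators and idempotents of $T(\mathcal{S})$ *)

Section SpeciesAlgebraGenerators.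
Variables (k : fieldType) (I : finType) (S : species k I).
Local Notation T := (species_algebra S).

Definition sring_in i (d : sD S i) : species_ring S :=
  @dinj _ (fun i : I => sD S i : zmodType) i d.

(** The idempotent $e_i$ is [vert_emb (1 : sD S i)]. *)
Definition vert_emb i (d : sD S i) : T :=
  @tin _ (species_bimod S) 0 (sring_in d).

Lemma vert_embD i : additive_fun (@vert_emb i).
Proof. by move=> d d'; rewrite /vert_emb /sring_in dinjD tinD. Qed.

Lemma vert_emb_mul i (d : sD S i) (x : T) : vert_emb d * x = sring_in d *: x.
Proof. exact: tmul_tin. Qed.

Lemma vert_embM i (d d' : sD S i) :
  vert_emb (d * d') = vert_emb d * vert_emb d'.
Proof.
rewrite vert_emb_mul tscale_tin; congr tin; apply: dsum_eq => j.
transitivity (sring_in d j * sring_in d' j) => //.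
have [<-|ne] := eqVneq i j; first by rewrite /sring_in !dinjE.
by rewrite /sring_in !(dinj_neq _ ne) mul0r.
Qed.

Lemma vert_emb_orth i j (d : sD S i) (d' : sD S j) :
  i != j -> vert_emb d * vert_emb d' = 0.
Proof.
move=> ne; rewrite vert_emb_mul tscale_tin.
rewrite -[RHS](@tin0 _ (species_bimod S) 0); congr tin.
apply: dsum_eq => l; transitivity (sring_in d l * sring_in d' l) => //.
have [il|nil] := eqVneq i l; last by rewrite /sring_in (dinj_neq _ nil) mul0r.
by rewrite /sring_in (dinj_neq d') ?mulr0 // -il eq_sym.
Qed.

(** With [vert_embM] and [vert_emb_orth], this makes the $e_i$ a complete system of orthogonal
    idempotents. *)
Lemma sum_vert_emb1 : \sum_i vert_emb (1 : sD S i) = 1.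
Proof.
transitivity (@tin _ (species_bimod S) 0 (\sum_i sring_in (1 : sD S i))).
  by apply/esym/additive_fun_sum => x y; apply: tinD.
congr tin; apply: dsum_eq => j; rewrite dsum_sumE (bigD1 j) //=.
rewrite [dinj_coef _ _](dinjE (1 : sD S j)) big1 ?addr0 // => i ij.
exact: dinj_neq.
Qed.

Lemma vert_emb_arrow j i (d : sD S j) (m : sM S j i) :
  vert_emb d * arrow_emb m = arrow_emb (d *: m).
Proof. by rewrite vert_emb_mul arrow_emb_scale. Qed.

Lemma arrow_emb_vert j i (m : sM S j i) (d : sD S i) :
  arrow_emb m * vert_emb d = arrow_emb (ract m d).
Proof.
rewrite -[RHS]mulr1 arrow_emb_ract; congr *%R.
by rewrite -[LHS]mulr1; exact: vert_emb_mul.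
Qed.

(** As a ring, $T(\mathcal{S})$ is generated by the $D_i$ and the ${}_jM_i$: an elementary tensor of
    degree at least two is a product of elements of degree one, and [D] and [M] are themselves
    direct sums of their components. *)
Lemma species_algebra_ind (Q : T -> Prop) : Q 0 ->
  (forall x y, Q x -> Q y -> Q (x + y)) ->
  (forall x y, Q x -> Q y -> Q (x * y)) ->
  (forall i (d : sD S i), Q (vert_emb d)) ->
  (forall j i (m : sM S j i), Q (arrow_emb m)) -> forall x, Q x.
Proof.
move=> Q0 QD QM Qv Qa x.
have QM1 (m : species_bimod S) : Q (tin (n := 1) m).
  move: m; apply: dsum_ind => [|m m' Qm Qm'|[j i] m]; last exact: Qa.
    by rewrite [tin _]tin0.
  by rewrite [tin _]tinD; apply: QD.
elim/tmul_ind: x => [|//|[|n] x]; first exact: Q0.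
- move: x; apply: dsum_ind => [|d d' Qd Qd'|i d]; last exact: Qv.
    by rewrite [tin _]tin0.
  by rewrite [tin _]tinD; apply: QD.
- elim: n x => [|n IHn] x; first exact: QM1.
  elim/tens_ind: x => [|x y Qx Qy|m t].
  + by rewrite [tin _]tin0.
  + by rewrite [tin _]tinD; apply: QD.
  + have -> : tin (n := n.+2) (tensor m t) = tin (n := 1) m * tin (n := n.+1) t.
      by rewrite [RHS]tmul_tin [RHS]tshift_tinS.
    exact: QM.
Qed.

Lemma path_emb_scale i j (p : qpath S i j) d (t : path_tens p) :
  path_emb (d *: t) = vert_emb d * path_emb t.
Proof. by rewrite vert_emb_mul; case: (path_emb_spec p) => _; apply. Qed.

Lemma path_embD i j (p : qpath S i j) : additive_fun (@path_emb _ _ S i j p).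
Proof. by case: (path_emb_spec p). Qed.

(** A right scalar acts on the innermost tensor factor, reached by the recursion only at the first
    arrow; hence the induction on the path. *)
Lemma path_emb_ract i j (p : qpath S i j) (t : path_tens p) d :
  path_emb (ract t d) = path_emb t * vert_emb d.
Proof.
elim: p t => {j} [j a|j l p IHp a] t; first by rewrite arrow_emb_vert.
have D := @path_embD _ _ (qcons p a); have D0 := additive_fun0 D.
elim/tens_ind: t => [|x y IHx IHy|m t].
- by rewrite ract0 D0 mul0r.
- by rewrite ractDl !D mulrDl IHx IHy.
- by rewrite [ract _ _]tens_ract_tensor !path_emb_tensor IHp mulrA.
Qed.

Lemma path_bimod_embD j i : additive_fun (@path_bimod_emb _ _ S j i).
Proof. by apply: dliftD => p; exact: path_embD. Qed.

(** Together with [path_bimod_emb_ract], this shows that ${}_j\mathcal{M}_i \to T(\mathcal{S})$ is a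
    bimodule map, so that preimages of two-sided ideals are sub-bimodules. *)
Lemma path_bimod_emb_scale i j d (x : path_bimod S j i) :
  path_bimod_emb (d *: x) = vert_emb d * path_bimod_emb x.
Proof.
have D := @path_bimod_embD j i; have D0 := additive_fun0 D.
move: x; apply: dsum_ind => [|x y IHx IHy|p t].
- by rewrite scaler0 D0 mulr0.
- by rewrite scalerDr !D IHx IHy mulrDr.
- have -> : d *: (path_in t : path_bimod S j i) = path_in (d *: t).
    apply: dsum_eq => q; transitivity (d *: path_in t q) => //.
    have [<-|ne] := eqVneq p q; first by rewrite !dinjE.
    by rewrite !(dinj_neq _ ne) scaler0.
  by rewrite !path_bimod_embE path_emb_scale.
Qed.

Lemma path_bimod_emb_ract i j (x : path_bimod S j i) d :
  path_bimod_emb (ract x d) = path_bimod_emb x * vert_emb d.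
Proof.
have D := @path_bimod_embD j i; have D0 := additive_fun0 D.
move: x; apply: dsum_ind => [|x y IHx IHy|p t].
- by rewrite ract0 D0 mul0r.
- by rewrite ractDl !D IHx IHy mulrDl.
- have -> : ract (path_in t : path_bimod S j i) d = path_in (ract t d).
    apply: dsum_eq => q; transitivity (ract (path_in t q) d) => //.
    have [<-|ne] := eqVneq p q; first by rewrite !dinjE.
    by rewrite !(dinj_neq _ ne) ract0.
  by rewrite !path_bimod_embE path_emb_ract.
Qed.

End SpeciesAlgebraGenerators.

(** * The $T(\mathcal{S})$-module of a representation *)

Section RepModule.
Variables (k : fieldType) (I : finType) (S : species k I).
Local Notation T := (species_algebra S).

Section OneRep.
Variable V : rep S.

Definition rep_sum := dsum (fun i => V i : zmodType).
HB.instance Definition _ := GRing.Zmodule.on rep_sum.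

(** Since [I] is finite, the direct sum of the $V_i$ is also their product, and its elements may be
    given as arbitrary families. *)
Fact rep_family_fin (f : forall i, V i) : finite_set [set i | f i != 0].
Proof. exact: finite_finset. Qed.
Definition rep_family (f : forall i, V i) : rep_sum :=
  @DSum _ (fun i => V i : zmodType) f (rep_family_fin f).

Definition rep_in i (v : V i) : rep_sum :=
  @dinj _ (fun i => V i : zmodType) i v.

Lemma rep_in_sum (u : rep_sum) : u = \sum_i rep_in (u i).
Proof.
apply: dsum_eq => j; rewrite dsum_sumE (bigD1 j) //= [dinj_coef _ _]dinjE.
by rewrite big1 ?addr0 // => i ij; exact: dinj_neq.
Qed.

Lemma rep_inD i : additive_fun (@rep_in i).
Proof. by move=> v w; exact: dinjD. Qed.

Lemma rep_in0 i : rep_in (0 : V i) = 0.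
Proof. exact: (additive_fun0 (@rep_inD i)). Qed.

Lemma rep_in_inj i : injective (@rep_in i).
Proof. by move=> v w /(congr1 (fun u : rep_sum => u i)); rewrite !dinjE. Qed.

Definition rep_sum_scale (d : species_ring S) (u : rep_sum) : rep_sum :=
  rep_family (fun i => d i *: u i).

Fact rep_sum_scaleA d e u :
  rep_sum_scale d (rep_sum_scale e u) = rep_sum_scale (d * e) u.
Proof. by apply: dsum_eq => i /=; rewrite scalerA. Qed.
Fact rep_sum_scale1 u : rep_sum_scale 1 u = u.
Proof. by apply: dsum_eq => i /=; rewrite scale1r. Qed.
Fact rep_sum_scaleDr d : additive_fun (rep_sum_scale d).
Proof. by move=> u v; apply: dsum_eq => i /=; rewrite scalerDr. Qed.
Fact rep_sum_scaleDl u : additive_fun (rep_sum_scale^~ u).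
Proof. by move=> d e; apply: dsum_eq => i /=; rewrite scalerDl. Qed.

Definition rep_sum_lmod : lmodType (species_ring S) :=
  lmod_of_act rep_sum_scaleA rep_sum_scale1 rep_sum_scaleDr rep_sum_scaleDl.

(** An element of [M] acts as a matrix with entries in the ${}_jM_i$ acts on a column vector,
    entries being multiplied through the maps of [V]. *)
Definition rep_phi (m : species_bimod S) (u : rep_sum_lmod) : rep_sum_lmod :=
  rep_family (fun j =>
    \sum_i rmap V j i (tensor ((m : species_mod S) (j, i)) (u i))).

Fact rep_phi_bal : balanced rep_phi.
Proof.
split=> [u m m'|m u u'|m d u]; apply: dsum_eq => j; rewrite ?dsumDE /=.
- by rewrite -big_split; apply: eq_bigr => i _; rewrite /= tensorDl linearD.
- by rewrite -big_split; apply: eq_bigr => i _; rewrite /= tensorDr linearD.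
- by apply: eq_bigr => i _; rewrite tensor_bal.
Qed.

Fact rep_phiZ d m u : rep_phi (d *: m) u = d *: rep_phi m u.
Proof.
apply: dsum_eq => j /=; rewrite scaler_sumr; apply: eq_bigr => i _.
by rewrite -linearZ tensorZ.
Qed.

Definition rep_module : lmodType T := tensor_module rep_phi_bal rep_phiZ.

(** In particular $e_i$ acts as the projection onto the summand $V_i$. *)
Lemma vert_emb_act i (d : sD S i) (u : rep_module) :
  vert_emb d *: u = rep_in (d *: (u : rep_sum) i) :> rep_sum.
Proof.
rewrite [LHS](@tensor_module_tin0 _ _ _ _ rep_phi_bal rep_phiZ).
apply: dsum_eq => j; transitivity (sring_in d j *: (u : rep_sum) j) => //.
have [<-|ne] := eqVneq i j; first by rewrite [RHS]dinjE [sring_in d i]dinjE.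
by rewrite [RHS]dinj_neq // [sring_in d j]dinj_neq // scale0r.
Qed.

Lemma arrow_emb_act j i (m : sM S j i) (u : rep_module) :
  arrow_emb m *: u =
  rep_in (rmap V j i (tensor m ((u : rep_sum) i))) :> rep_sum.
Proof.
rewrite [LHS](@tensor_module_tin1 _ _ _ _ rep_phi_bal rep_phiZ).
apply: dsum_eq => j' /=.
pose mm : species_mod S :=
  @dinj _ (fun p : I * I => sM S p.1 p.2 : zmodType) (j, i) m.
transitivity
  (\sum_i' rmap V j' i' (tensor (mm (j', i')) ((u : rep_sum) i'))) => //.
have t0 i' (v : V i') : rmap V j' i' (tensor 0 v) = 0.
  rewrite -[RHS](linear0 (rmap V j' i')); congr (rmap V _ _ _).
  by rewrite -(scale0r (0 : sM S j' i')) -tensorZ scale0r.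
have [e|ne] := eqVneq j j'; last first.
  rewrite big1 => [|i' _]; first by rewrite [RHS](dinj_neq _ ne).
  by rewrite /mm dinj_neq // xpair_eqE (negPf ne).
case: _ / e => {j'} in t0 *.
rewrite (bigD1 i) //= big1 => [|i' i'i].
  by rewrite addr0 [RHS]dinjE [dinj_coef _ _](dinjE (p := (j, i)) m).
by rewrite [dinj_coef _ _]dinj_neq // xpair_eqE eqxx eq_sym.
Qed.

(** Induction along the path: the action of each arrow lands in the summand at its target, exactly
    the one that the next arrow reads. *)
Lemma path_emb_act i j (p : qpath S i j) (t : path_tens p) (u : rep_module) :
  path_emb t *: u = rep_in (path_act t ((u : rep_sum) i)) :> rep_sum.
Proof.
elim: p t => {j} [j a|j l p IHp a] t; first exact: arrow_emb_act.
have D := @path_embD _ _ _ _ _ (qcons p a); have D0 := additive_fun0 D.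
have [aD _ _ _] := path_act_spec V (qcons p a).
have aD0 := additive_fun0 (aD ((u : rep_sum) i)).
elim/tens_ind: t => [|x y IHx IHy|m t].
- by rewrite D0 aD0 scale0r [RHS]rep_in0.
- by rewrite D aD scalerDl IHx IHy [RHS]rep_inD.
- rewrite path_emb_tensor -scalerA arrow_emb_act; congr rep_in.
  rewrite IHp dinjE; apply/esym.
  apply: (tliftE (beta := fun (m : sM S l j) (t : path_tens p) =>
    rmap V l j (tensor m (path_act t ((u : rep_sum) i))))).
  have [bD _ _ bZ] := path_act_spec V p.
  split=> [t' m' m''|m' t' t''|m' d t'].
  + by rewrite tensorDl linearD.
  + by rewrite bD tensorDr linearD.
  + by rewrite tensor_bal bZ.
Qed.

(** This links the two sides of the theorem: multiplication in the module restricts to ${}_jf_i$ on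
    $V_i$, so relations can be compared with the ideal they generate. *)
Lemma path_bimod_emb_act i j (x : path_bimod S j i) (v : V i) :
  path_bimod_emb x *: (rep_in v : rep_module) =
  rep_in (rep_f (tensor x v)) :> rep_sum.
Proof.
pose beta (x : path_bimod S j i) (v : V i) : V j :=
  dlift (fun (p : qpath S i j) (t : path_tens p) => path_act t v) x.
have aD (w : V i) (p : qpath S i j) :
    additive_fun (fun t : path_tens p => path_act t w).
  by case: (path_act_spec V p) => h _ _ _; exact: h.
have bD w : additive_fun (beta^~ w) by exact: dliftD.
have embD := @path_bimod_embD _ _ S j i.
(* The formula is proved for [beta] before [beta] is known to be balanced; only afterwards may the
   lift in [rep_f] be evaluated. *)
have bE y w : path_bimod_emb y *: (rep_in w : rep_module) =
    rep_in (beta y w) :> rep_sum.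
  move: y; apply: dsum_ind => [|y z IHy IHz|p t].
  - by rewrite (additive_fun0 embD) (additive_fun0 (bD w)) scale0r [RHS]rep_in0.
  - by rewrite embD scalerDl IHy IHz -rep_inD bD.
  - by rewrite path_bimod_embE path_emb_act dinjE /beta dlift_inj.
rewrite bE /rep_f tliftE //.
(* [rep_in] is injective, so balancedness is inherited from the module laws. *)
split=> [w|y w w'|y d w]; first exact: bD.
- apply: (@rep_in_inj j); rewrite rep_inD -!bE rep_inD.
  exact: (scalerDr (path_bimod_emb y) (rep_in w : rep_module) (rep_in w')).
- apply: (@rep_in_inj j); rewrite -!bE path_bimod_emb_ract -scalerA.
  by rewrite vert_emb_act [rep_in w i]dinjE.
Qed.

End OneRep.
End RepModule.

(** * Linear maps, module isomorphisms, and linearity tested on generators *)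

Section LinearOf.
Variables (R : pzRingType) (U V : lmodType R) (g : U -> V).
Hypotheses (gD : additive_fun g) (gZ : forall a u, g (a *: u) = a *: g u).

Fact linear_of_linear : linear g. Proof. by move=> a u v; rewrite gD gZ. Qed.
Definition linear_of : {linear U -> V} :=
  HB.pack g (GRing.isLinear.Build R U V _ g linear_of_linear).
End LinearOf.

Lemma Mod_bijective_isoc (R : pzRingType) (U V : lmodType R)
  (f : {linear U -> V}) : bijective f -> @is_isoc (Mod R) U V f.
Proof.
move=> [g fK gK].
have gD : additive_fun g.
  by move=> x y; apply: (can_inj fK); rewrite linearD !gK.
have gZ a x : g (a *: x) = a *: g x.
  by apply: (can_inj fK); rewrite linearZ !gK.
by exists (linear_of gD gZ); split; apply: linear_eq.
Qed.

Section SpeciesAlgebraLinear.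
Variables (k : fieldType) (I : finType) (S : species k I).
Local Notation T := (species_algebra S).

(** The [x] satisfying the conclusion for all [u] are closed under sums and products, so the
    generators suffice. This serves both for the functor on morphisms and for [corner_sum]. *)
Lemma species_algebra_linear (X : set T) (U : lmodType T)
    (W : lmodType (quot_ring X)) (g : U -> W) : additive_fun g ->
  (forall i (d : sD S i) u,
     g (vert_emb d *: u) = quot_pi X (vert_emb d) *: g u) ->
  (forall j i (m : sM S j i) u,
     g (arrow_emb m *: u) = quot_pi X (arrow_emb m) *: g u) ->
  forall x u, g (x *: u) = quot_pi X x *: g u.
Proof.
move=> gD gv ga; elim/species_algebra_ind => // [u|x y IHx IHy u|x y IHx IHy u].
- have -> : quot_pi X 0 = 0 by exact: (additive_fun0 (@quot_piD _ X)).
  by rewrite !scale0r (additive_fun0 gD).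
- by rewrite scalerDl gD IHx IHy quot_piD scalerDl.
- by rewrite -scalerA IHx IHy scalerA; congr (_ *: _); rewrite [RHS]quot_piM.
Qed.
End SpeciesAlgebraLinear.

(** * The functor from representations to modules, full and faithful *)

Section RepToMod.
Variables (k : fieldType) (I : finType) (S : species k I).
Variable rho : forall a b : I, set (path_bimod S b a).
Local Notation X := (relation_ideal_gens rho).
Local Notation C := (RepCat rho).
Local Notation M := (Mod (quot_ring X)).

(** As $\sigma = \sigma e_a$ in $T(\mathcal{S})$, only the component of [u] in $V_a$ matters, and
    there $\sigma$ acts by ${}_bf_a$, which vanishes on it. *)
Lemma satisfies_kills (V : rep S) : satisfies rho V ->
  forall x (u : rep_module V), X x -> x *: u = 0.
Proof.
move=> Vrho x u [a [b [sigma sigma_rho ->]]].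
rewrite -[sigma]ract1 path_bimod_emb_ract -scalerA vert_emb_act.
rewrite path_bimod_emb_act (Vrho _ _ _ sigma_rho) ?rep_in0 //.
by move=> N [_]; apply.
Qed.

Definition mod_of_rep (V : C) : M := quot_module (satisfies_kills (svalP V)).

Section OnMorphisms.
Variables (V W : C) (f : rep_hom (sval V) (sval W)).

Definition mod_of_rep_map (u : rep_sum (sval V)) : rep_sum (sval W) :=
  rep_family (fun i => rhom f i (u i)).

Lemma mod_of_rep_mapD : additive_fun mod_of_rep_map.
Proof. by move=> u v; apply: dsum_eq => i; rewrite dsumDE /= linearD. Qed.

Lemma mod_of_rep_map_in i (v : sval V i) :
  mod_of_rep_map (rep_in v) = rep_in (rhom f i v).
Proof.
apply: dsum_eq => j; transitivity (rhom f j (rep_in v j)) => //.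
have [<-|ne] := eqVneq i j; first by rewrite !dinjE.
by rewrite [rep_in v j]dinj_neq // linear0 [RHS]dinj_neq.
Qed.

(** On generators, linearity says that each [rhom f i] is $D_i$-linear and that [f] commutes with
    the structure maps. *)
Lemma mod_of_rep_map_linear (a : quot_ring X) (u : mod_of_rep V) :
  mod_of_rep_map (a *: u) =
  a *: (mod_of_rep_map u : mod_of_rep W) :> mod_of_rep W.
Proof.
rewrite -[a]quot_pi_repr; move: (repr a) => {}a; rewrite quot_moduleE.
move: a u; apply: (species_algebra_linear (U := rep_module (sval V))
  (W := mod_of_rep W) (g := mod_of_rep_map)); first exact: mod_of_rep_mapD.
- move=> i d u; rewrite quot_moduleE !vert_emb_act mod_of_rep_map_in.
  by rewrite linearZ.
- move=> j i m u; rewrite quot_moduleE !arrow_emb_act mod_of_rep_map_in.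
  by rewrite -rhom_comm tens_map_tensor.
Qed.

Definition mod_of_rep_hom : hom (mod_of_rep V) (mod_of_rep W) :=
  linear_of (U := mod_of_rep V) (V := mod_of_rep W) mod_of_rep_mapD
    mod_of_rep_map_linear.
End OnMorphisms.

Fact mod_of_rep_hom1 (V : C) :
  mod_of_rep_hom (V := V) (W := V) (idc V) = idc (mod_of_rep V).
Proof. by apply: linear_eq => u; exact: dsum_eq. Qed.

Fact mod_of_rep_homM (U V W : C) (f : hom V W) (g : hom U V) :
  mod_of_rep_hom (V := U) (W := W) (compc f g) =
  compc (mod_of_rep_hom f) (mod_of_rep_hom g).
Proof. by apply: linear_eq => u; exact: dsum_eq. Qed.

Definition mod_of_rep_functor : functor C M :=
  Functor mod_of_rep_hom1 mod_of_rep_homM.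

Lemma mod_of_rep_faithful (V W : C) (f g : hom V W) :
  mod_of_rep_hom f = mod_of_rep_hom g -> f = g.
Proof.
move=> fg; apply: rep_hom_eq => i v; apply: (@rep_in_inj _ _ _ (sval W) i).
rewrite -!mod_of_rep_map_in.
exact: (congr1 (fun h : {linear _ -> _} => h (rep_in v : mod_of_rep V)) fg).
Qed.

Lemma mod_of_rep_full (V W : C) (h : hom (mod_of_rep V) (mod_of_rep W)) :
  exists f, mod_of_rep_hom f = h.
Proof.
pose hl : {linear mod_of_rep V -> mod_of_rep W} := h.
pose hh : rep_sum (sval V) -> rep_sum (sval W) := hl.
have hD : additive_fun hh by move=> u v; exact: (linearD hl).
have hT x (u : rep_module (sval V)) :
    hh (x *: u) = x *: (hh u : rep_module (sval W)).
  have := linearZZ hl (quot_pi X x) u.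
  by rewrite !quot_moduleE.
pose f0 i (v : sval V i) : sval W i := hh (rep_in v) i.
(* Since $e_i$ fixes [rep_in v], it also fixes its image, which therefore lies in the summand at
   [i]. *)
have hin i (v : sval V i) : hh (rep_in v) = rep_in (f0 i v).
  have := hT (vert_emb (1 : sD S i)) (rep_in v).
  by rewrite !vert_emb_act !scale1r dinjE.
have f0D i : additive_fun (f0 i) by move=> v w; rewrite /f0 rep_inD hD.
have f0Z i a v : f0 i (a *: v) = a *: f0 i v.
  apply: rep_in_inj; rewrite -hin.
  have := hT (vert_emb (a : sD S i)) (rep_in v).
  by rewrite !vert_emb_act dinjE.
pose f1 i := linear_of (f0D i) (f0Z i).
have f1_comm j i (x : tens (sM S j i) (sval V i)) :
    rmap (sval W) j i (tens_map (f1 i) x) = f1 j (rmap (sval V) j i x).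
  have D := tliftD (tens_map_bal (sM S j i) (f1 i)).
  elim/tens_ind: x => [|x y IHx IHy|m v].
  - by rewrite [tens_map _ 0](additive_fun0 D) !linear0.
  - by rewrite [tens_map _ _]D !linearD IHx IHy.
  (* Linearity of [hh] with respect to [arrow_emb m] is the commuting square on [tensor m v]. *)
  - rewrite tens_map_tensor; apply: rep_in_inj; rewrite -[RHS]hin.
    have := hT (arrow_emb m) (rep_in v).
    by rewrite !arrow_emb_act dinjE => ->.
exists (RepHom f1_comm); apply: linear_eq => u; rewrite [u]rep_in_sum.
transitivity (mod_of_rep_map (RepHom f1_comm) (\sum_i rep_in (u i))) => //.
rewrite (additive_fun_sum _ _ _ (mod_of_rep_mapD _)) [RHS]linear_sum.
by apply: eq_bigr => i _; rewrite mod_of_rep_map_in [RHS]hin.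
Qed.

End RepToMod.

(** * The representation cut out of a module by the idempotents *)

Section TensorLinear.
Variables (S R : pzRingType) (A : bimod S R) (B : lmodType R) (V : lmodType S).
Variable beta : A -> B -> V.
Hypothesis bal : balanced beta.
Hypothesis betaZ : forall s a b, beta (s *: a) b = s *: beta a b.

Fact tlift_scale s (x : tens A B) : tlift beta (s *: x) = s *: tlift beta x.
Proof.
have D := tliftD bal; have D0 := additive_fun0 D.
elim/tens_ind: x => [|x y IHx IHy|a b]; first by rewrite !(scaler0, D0).
  by rewrite scalerDr !D IHx IHy scalerDr.
by rewrite tensorZ !tliftE.
Qed.

Definition tlift_linear : {linear tens A B -> V} :=
  linear_of (tliftD bal) tlift_scale.
End TensorLinear.

Section ModToRep.
Variables (k : fieldType) (I : finType) (S : species k I).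
Variables (X : set (species_algebra S)) (W : lmodType (quot_ring X)).

Local Notation pi := (quot_pi X).

Lemma quot_pi_scaleM x y (w : W) : pi (x * y) *: w = pi x *: (pi y *: w).
Proof. by rewrite quot_piM scalerA. Qed.

(* e_i W, with e_i the identity of D_i *)
Definition corner i : {pred W} :=
  fun w => pi (vert_emb (1 : sD S i)) *: w == w.

Fact corner_zmod_closed i : zmod_closed (corner i).
Proof.
split=> [|x y /eqP xi /eqP yi]; apply/eqP; first exact: scaler0.
by rewrite scalerBr xi yi.
Qed.
HB.instance Definition _ i :=
  GRing.isZmodClosed.Build W (corner i) (corner_zmod_closed i).

Record corner_type i := Corner { corner_val : W; _ : corner_val \in corner i }.
HB.instance Definition _ i := [isSub for @corner_val i].
HB.instance Definition _ i := [Choice of corner_type i by <:].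
HB.instance Definition _ i := [SubChoice_isSubZmodule of corner_type i by <:].

Lemma corner_valD i : additive_fun (\val : corner_type i -> W).
Proof. exact: (raddfD (\val : corner_type i -> W)). Qed.

Lemma cornerP i (w : corner_type i) :
  pi (vert_emb (1 : sD S i)) *: \val w = \val w.
Proof. by apply/eqP; exact: (valP w). Qed.

(** This holds because $e_i d = d$. As [w] is arbitrary, [d = 1] gives the projection of [W] onto
    $e_iW$. *)
Fact vert_emb_corner i (d : sD S i) (w : W) : pi (vert_emb d) *: w \in corner i.
Proof. by apply/eqP; rewrite -quot_pi_scaleM -vert_embM mul1r. Qed.

Fact arrow_emb_corner j i (m : sM S j i) (w : W) :
  pi (arrow_emb m) *: w \in corner j.
Proof. by apply/eqP; rewrite -quot_pi_scaleM vert_emb_arrow scale1r. Qed.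

Definition corner_scale i (d : sD S i) (w : corner_type i) : corner_type i :=
  Corner (vert_emb_corner d (\val w)).

Lemma corner_scaleE i (d : sD S i) w :
  \val (corner_scale d w) = pi (vert_emb d) *: \val w.
Proof. by []. Qed.

Fact corner_scaleA i (d e : sD S i) w :
  corner_scale d (corner_scale e w) = corner_scale (d * e) w.
Proof. by apply: val_inj; rewrite /= vert_embM quot_pi_scaleM. Qed.
Fact corner_scale1 i (w : corner_type i) : corner_scale 1 w = w.
Proof. by apply: val_inj; exact: cornerP. Qed.
Fact corner_scaleDr i (d : sD S i) : additive_fun (corner_scale d).
Proof.
by move=> v w; apply: val_inj; rewrite !(corner_scaleE, corner_valD) scalerDr.
Qed.
Fact corner_scaleDl i (w : corner_type i) :
  additive_fun ((@corner_scale i)^~ w).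
Proof.
move=> d e; apply: val_inj.
by rewrite !(corner_scaleE, corner_valD) vert_embD quot_piD scalerDl.
Qed.

Definition corner_lmod i : lmodType (sD S i) :=
  lmod_of_act (@corner_scaleA i) (@corner_scale1 i) (@corner_scaleDr i)
    (@corner_scaleDl i).

Definition corner_arrow j i (m : sM S j i) (w : corner_lmod i) :
    corner_lmod j :=
  Corner (arrow_emb_corner m (\val (w : corner_type i))).

Fact corner_arrow_bal j i : balanced (@corner_arrow j i).
Proof.
split=> [w m m'|m w w'|m d w]; apply: val_inj.
- by rewrite [RHS]corner_valD /= arrow_embD quot_piD scalerDl.
- by rewrite [RHS]corner_valD /= -scalerDr.
- by rewrite /= -arrow_emb_vert quot_pi_scaleM.
Qed.

Fact corner_arrowZ j i d (m : sM S j i) w :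
  corner_arrow (d *: m) w = d *: corner_arrow m w.
Proof. by apply: val_inj; rewrite /= -vert_emb_arrow quot_pi_scaleM. Qed.

Definition corner_rep : rep S :=
  @Rep _ _ S corner_lmod
    (fun j i => tlift_linear (@corner_arrow_bal j i) (@corner_arrowZ j i)).

Definition corner_sum (u : rep_sum corner_rep) : W :=
  \sum_i \val (u i : corner_type i).

Lemma corner_sumD : additive_fun corner_sum.
Proof.
move=> u v; rewrite -big_split; apply: eq_bigr => i _.
by rewrite dsumDE [LHS]corner_valD.
Qed.

Lemma corner_sum_in i (w : corner_rep i) :
  corner_sum (rep_in w) = \val (w : corner_type i).
Proof.
rewrite /corner_sum (bigD1 i) //= [dinj_coef _ _]dinjE big1 ?addr0 // => j ji.
by rewrite [dinj_coef _ _]dinj_neq 1?eq_sym //.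
Qed.

(** By orthogonality $e_i$ kills every term but the one at [i], so the components of [u] are
    recovered from their sum. *)
Lemma vert_emb_corner_sum i (u : rep_sum corner_rep) :
  pi (vert_emb (1 : sD S i)) *: corner_sum u = \val (u i : corner_type i).
Proof.
rewrite /corner_sum scaler_sumr (bigD1 i) //= cornerP big1 ?addr0 // => j ji.
rewrite -cornerP -quot_pi_scaleM vert_emb_orth 1?eq_sym //.
by rewrite (additive_fun0 (@quot_piD _ X)) scale0r.
Qed.

Lemma corner_sum_linear x (u : rep_module corner_rep) :
  corner_sum (x *: u) = pi x *: corner_sum u.
Proof.
move: x u; apply: (species_algebra_linear (U := rep_module corner_rep)).
- exact: corner_sumD.
- move=> i d u; rewrite vert_emb_act corner_sum_in.
  (* Writing $d = d e_i$ makes the right-hand side see only the component at [i]; the arrow case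
     uses $m = m e_i$ likewise. *)
  rewrite -[d in RHS]mulr1 vert_embM quot_pi_scaleM.
  by rewrite vert_emb_corner_sum.
- move=> j i m u; rewrite arrow_emb_act corner_sum_in /=.
  rewrite tliftE; last exact: corner_arrow_bal.
  rewrite -[m in RHS]ract1 -arrow_emb_vert quot_pi_scaleM.
  by rewrite vert_emb_corner_sum.
Qed.

(** The inverse sends [w] to the family of the $e_i w$: one composite is the identity by
    orthogonality, the other because the $e_i$ sum to 1. *)
Lemma corner_sum_bij : bijective corner_sum.
Proof.
exists (fun w => rep_family (V := corner_rep)
                   (fun i => Corner (vert_emb_corner 1 w))).
  move=> u; apply: dsum_eq => i; apply: val_inj.
  by rewrite /= vert_emb_corner_sum.
move=> w; rewrite /corner_sum /= -scaler_suml.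
rewrite -(additive_fun_sum _ _ _ (@quot_piD _ X)) sum_vert_emb1.
exact: scale1r.
Qed.

End ModToRep.

(** * Essential surjectivity and the equivalence *)

Section EssentiallySurjective.
Variables (k : fieldType) (I : finType) (S : species k I).
Variable rho : forall a b : I, set (path_bimod S b a).
Local Notation X := (relation_ideal_gens rho).

(** The elements of ${}_b\mathcal{M}_a$ that embed into $\langle\rho\rangle$ form a sub-bimodule
    containing $\sigma$, hence containing [n]; so [n] acts as zero on [W]. *)
Lemma corner_rep_satisfies (W : lmodType (quot_ring X)) :
  satisfies rho (corner_rep W).
Proof.
move=> a b sigma sigma_rho n v n_sigma.
(* The difference with 0 lets [quot_piP] turn ideal membership into equality with the class of 0. *)
have /quot_piP pi_n : gen_ideal X (path_bimod_emb n - 0).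
  rewrite subr0; have [J0 JB JMl JMr] := gen_idealP X.
  have embD := @path_bimod_embD _ _ S b a.
  apply: (n_sigma [set y | gen_ideal X (path_bimod_emb y)]).
  split; last by move=> _ -> J [_]; apply; exists a, b, sigma.
  split=> [|x y Jx Jy|d x Jx|x d Jx] /=.
  - by rewrite (additive_fun0 embD).
  - have -> : path_bimod_emb (x - y) = path_bimod_emb x - path_bimod_emb y.
      by apply: (addIr (path_bimod_emb y)); rewrite -embD !subrK.
    exact: JB.
  - by rewrite path_bimod_emb_scale; exact: JMl.
  - by rewrite path_bimod_emb_ract; exact: JMr.
(* The equation in $V_b$ is carried to [W] along two injective maps, where [pi_n] applies. *)
apply: (@rep_in_inj _ _ _ (corner_rep W) b).
apply: (bij_inj (corner_sum_bij W)).
rewrite -path_bimod_emb_act corner_sum_linear pi_n.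
rewrite rep_in0 (additive_fun0 (@corner_sumD _ _ _ _ W)).
by rewrite (additive_fun0 (@quot_piD _ X)) scale0r.
Qed.

Lemma mod_of_rep_esssurj (W : Mod (quot_ring X)) :
  exists (V : RepCat rho) (f : hom (mod_of_rep_functor rho V) W), is_isoc f.
Proof.
pose V : RepCat rho := exist _ _ (@corner_rep_satisfies W).
have cZ (a : quot_ring X) (u : mod_of_rep V) :
    corner_sum (a *: u) = a *: corner_sum (u : rep_sum (corner_rep W)).
  rewrite -[a]quot_pi_repr; rewrite quot_moduleE.
  exact: corner_sum_linear.
exists V, (linear_of (U := mod_of_rep V) (@corner_sumD _ _ _ _ W) cZ).
exact/Mod_bijective_isoc/corner_sum_bij.
Qed.

End EssentiallySurjective.

Theorem proposition2p3 (k : fieldType) (I : finType) (S : species k I)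
    (rho : forall a b : I, set (path_bimod S b a))
    (rho_rel : forall (a b : I) (sigma : path_bimod S b a),
       rho a b sigma -> is_relation sigma) :
  equivalent_categories
    (RepCat rho)
    (Mod (quot_ring (relation_ideal_gens rho))).
Proof.
apply: (@fully_faithful_equivalence _ _ (mod_of_rep_functor rho)).
- exact: mod_of_rep_full.
- exact: mod_of_rep_faithful.
- exact: mod_of_rep_esssurj.
Qed.
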